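(* Let $\mathcal H,\mathcal K$ be complex Hilbert spaces and $A\in\mathcal B(\mathcal H,\mathcal K)$. (a) The norm closure of $\{AG: G\in\mathcal G(\mathcal H)\}$ in $\mathcal B(\mathcal H,\mathcal K)$ consists of precisely those $B\in\mathcal B(\mathcal H,\mathcal K)$ such that $BB^*\in\mathcal L_+(AA^* )$ and $$\iota_i(B)=\iota_i(A)+\iota_i\bigl(B^*\bigr|_{\overline{\mathcal R}(A)}\bigr).$$ (b) The norm closure of $\{GA: G\in\mathcal G(\mathcal K)\}$ in $\mathcal B(\mathcal H,\mathcal K)$ consists of precisely those $B\in\mathcal B(\mathcal H,\mathcal K)$ such that $B^*B\in\mathcal L_+(A^*A)$ and $$\iota_f(B)=\iota_f(A)+\iota_i\bigl(B\bigr|_{\overline{\mathcal R}(A^* )}\bigr).$$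
   Context: Hilbert spaces are complex and of arbitrary dimension; $\dim$ is the Hilbert space dimension (the cardinality of an orthonormal basis), and sums of dimensions are cardinal sums. $\mathcal B(\mathcal H,\mathcal K)$ is the space of bounded linear operators $\mathcal H\to\mathcal K$ with the operator norm, $\mathcal B(\mathcal H)=\mathcal B(\mathcal H,\mathcal H)$, and $\mathcal B_+(\mathcal H)$ is the set of nonnegative bounded operators on $\mathcal H$. $\mathcal G(\mathcal H)$ is the group of all linear homeomorphisms of $\mathcal H$ onto itself. $\mathcal N(A)$, $\mathcal R(A)$, $\overline{\mathcal R}(A)$ denote the kernel, the range and the closure of the range of $A$. For a pre-Hilbert space $\mathcal E$ with completion $\overline{\mathcal E}$, $\mathrm{IC}(\mathcal E)=\min\{\dim(\overline{\mathcal E}\ominus V): V \text{ a complete linear subspace of }\mathcal E\}$ ($\ominus$ denotes orthogonal complement). For an operator $A\in\mathcal B(\mathcal H,\mathcal K)$: $\iota_i(A)=\dim\mathcal N(A)+\mathrm{IC}(\mathcal R(A))$ and $\iota_f(A)=\dim(\mathcal K\ominus\overline{\mathcal R}(A))+\mathrm{IC}(\mathcal R(A))$. The restriction $B^*|_{\overline{\mathcal R}(A)}$ is regarded as an element of $\mathcal B(\overline{\mathcal R}(A),\mathcal H)$ and $B|_{\overline{\mathcal R}(A^* )}$ as an element of $\mathcal B(\overline{\mathcal R}(A^* ),\mathcal K)$. For $T\in\mathcal B_+(\mathcal H)$, $L_+(T)$ is the set of all $S\in\mathcal B_+(\mathcal H)$ such that $S\le cT$ for some scalar $c>0$, and $\mathcal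 L_+(T)$ is the norm closure of $L_+(T)$ (and similarly on $\mathcal K$). *)

(* Defs.v *)
(* Complex scalars are [R[i]] for [R : realType]. *)
From HB Require Import structures.
From mathcomp Require Import all_boot all_order all_algebra.
From mathcomp Require Import sesquilinear complex.
From mathcomp Require Import all_classical all_reals all_analysis.

Set Implicit Arguments.
Unset Strict Implicit.
Unset Printing Implicit Defensive.

Import Order.TTheory GRing.Theory Num.Theory.
Import numFieldNormedType.Exports.

Local Open Scope classical_set_scope.
Local Open Scope card_scope.
Local Open Scope complex_scope.
Local Open Scope ring_scope.

(* The form is linear in its first argument and conjugate-linear in the
   second one. *)
HB.mixin Record CompleteNormedModule_isHilbert (R : realType) (H : Type)
    of CompleteNormedModule R[i] H := {
  hdot : {dot H for @Num.conj R[i]};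
  hdot_norm : forall x : H, `|x| ^+ 2 = hdot x x
}.

#[short(type="hilbertType")]
HB.structure Definition Hilbert (R : realType) :=
  {H of CompleteNormedModule_isHilbert R H & CompleteNormedModule R[i] H}.

HB.mixin Record isBoundedOp (R : realType) (H K : hilbertType R)
    (f : H -> K) := {
  bounded_op_subproof : exists M : R, forall x, `|f x| <= M%:C * `|x|
}.

#[short(type="boundedOpType")]
HB.structure Definition BoundedOp (R : realType) (H K : hilbertType R) :=
  {f of @GRing.Linear R[i] H K *:%R f & isBoundedOp R H K f}.

Notation "''B' ( H , K )" := (boundedOpType H K)
  (at level 0, format "''B' ( H ,  K )") : type_scope.

HB.instance Definition _ (R : realType) (H K : hilbertType R) :=
  gen_eqMixin 'B(H, K).
HB.instance Definition _ (R : realType) (H K : hilbertType R) :=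
  gen_choiceMixin 'B(H, K).

Section zero_and_composition.
Variables (R : realType) (H K L : hilbertType R).

Let zero_bounded : exists M : R, forall x : H, `|(\0 : H -> K) x| <= M%:C * `|x|.
Proof. by exists 0 => x; rewrite /= normr0 mul0r. Qed.

HB.instance Definition _ := isBoundedOp.Build R H K \0 zero_bounded.

Variables (g : 'B(K, L)) (f : 'B(H, K)).

Let comp_bounded : exists M : R, forall x, `|(g \o f) x| <= M%:C * `|x|.
Proof.
have [M gM] := @bounded_op_subproof _ _ _ g.
have [N fN] := @bounded_op_subproof _ _ _ f.
exists (Num.max M 0 * N) => x; apply: le_trans (gM _) _.
apply: (@le_trans _ _ ((Num.max M 0)%:C * `|f x|)).
  by apply: ler_wpM2r => //; rewrite lecR le_max lexx.
by rewrite rmorphM -mulrA; apply: ler_wpM2l => //; rewrite lecR le_max lexx orbT.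
Qed.

HB.instance Definition _ := isBoundedOp.Build R H L (g \o f) comp_bounded.

End zero_and_composition.

Section operators.
Variables (R : realType) (H K : hilbertType R).

(* The set below is a singleton by the Riesz representation theorem. *)
Definition adjoint (A : 'B(H, K)) : 'B(K, H) :=
  xget (\0 : 'B(K, H)) [set A' | forall x y, hdot (A x) y = hdot x (A' y)].

Definition opnorm (f : H -> K) : R :=
  sup [set complex.Re `|f x| | x in [set x : H | `|x| <= 1]].

Definition norm_closure (S : set 'B(H, K)) : set 'B(H, K) :=
  [set B : 'B(H, K) | forall e : R, 0 < e ->
     exists2 T, S T & opnorm (fun x => B x - T x) < e].

End operators.

Section positive_operators.
Variables (R : realType) (H : hilbertType R).
Implicit Types S T : 'B(H, H).

(* On R[i], [a <= b] means that [b - a] is a nonnegative real, so that the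
   operators below are automatically self-adjoint. *)
Definition nonneg_op : set 'B(H, H) :=
  [set S : 'B(H, H) | forall x, 0 <= hdot (S x) x].

Definition dominated T : set 'B(H, H) :=
  [set S : 'B(H, H) | nonneg_op S /\ exists2 c : R, 0 < c &
     forall x, hdot (S x) x <= hdot (c%:C *: T x) x].

Definition closed_dominated T : set 'B(H, H) := norm_closure (dominated T).

Definition linear_homeo : set 'B(H, H) :=
  [set G : 'B(H, H) | continuous G /\
     exists G' : H -> H, [/\ cancel G G', cancel G' G & continuous G']].

End positive_operators.

Section dimension.
Variables (R : realType) (H : hilbertType R).
Implicit Types V E : set H.

Definition linear_subspace V :=
  V 0 /\ forall (a : R[i]) x y, V x -> V y -> V (a *: x + y).

Definition complete_set V := forall F : set_system H,
  ProperFilter F -> F V -> cauchy F -> exists2 x, V x & F --> x.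

Definition linear_span E : set H := smallest linear_subspace E.

Definition orthonormal_set E :=
  (forall x, E x -> `|x| = 1) /\
  (forall x y, E x -> E y -> x <> y -> hdot x y = 0).

Definition orthonormal_basis V E :=
  orthonormal_set E /\ closure (linear_span E) = V.

(* A cardinal is represented by a set having it, to be compared with other
   cardinals by [#=] and [#<=] only. For a closed subspace [V], [hdim V] is
   some orthonormal basis of [V]. *)
Definition hdim V : set H := xget set0 [set E | orthonormal_basis V E].

Definition ominus V E : set H :=
  [set x | V x /\ forall y, E y -> hdot x y = 0].

(* [E] is a linear subspace of the complete space [H], hence its completion
   is its closure in [H]. The value is a representative (as for [hdim]) of the
   least cardinal in the family, which exists as cardinals are well ordered. *)
Definition IC E : set H :=
  let codims := [set c | exists V,
    [/\ linear_subspace V, complete_set V, V `<=` E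
      & c = hdim (ominus (closure E) V)]] in
  xget set0 [set c | codims c /\ forall c', codims c' -> c #<= c'].

End dimension.

Definition cardinal_add (T U : Type) (A : set T) (B : set U) : set (T + U) :=
  inl @` A `|` inr @` B.

Section indices.
Variables (R : realType) (H K : hilbertType R).

(* The initial index of the restriction of [T] to the closed subspace [D]:
   its kernel is the part of the kernel lying in [D], its range is [T @` D]. *)
Definition iota_i_on (D : set H) (T : 'B(H, K)) : set (H + K) :=
  cardinal_add (hdim [set x | D x /\ T x = 0]) (IC (T @` D)).

Definition iota_i (T : 'B(H, K)) : set (H + K) := iota_i_on setT T.

Definition iota_f (T : 'B(H, K)) : set (K + K) :=
  cardinal_add (hdim (ominus setT (closure (range T)))) (IC (range T)).

End indices.

(* Main.v *)
Require Import Defs.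
From HB Require Import structures.
From mathcomp Require Import all_boot all_order all_algebra.
From mathcomp Require Import sesquilinear complex.
From mathcomp Require Import all_classical all_reals all_analysis.
From mathcomp Require Import ring lra.

Set Implicit Arguments.
Unset Strict Implicit.
Unset Printing Implicit Defensive.

Import Order.TTheory GRing.Theory Num.Theory.
Import numFieldNormedType.Exports.

Local Open Scope classical_set_scope.
Local Open Scope card_scope.
Local Open Scope ring_scope.

(** Everything rests on one reading of the initial index: for a closed subspace
    [X], [iota_i_on X T] is the least codimension in [X] of a closed subspace
    on which [T] is bounded below ([iota_le_codim], [iota_attained]). That the
    minimum defining [IC] speaks of the same subspaces is the bounded inverse
    theorem ([bounded_below_section]): a complete subspace of the range of [T]
    is the image of a closed subspace on which [T] is bounded below. All
    dimensions are then computed by one formula ([codim_image]): if [T] is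
    bounded below on [V], the codimension of [V] in [X] is the dimension of the
    kernel of [T] on [X] plus the codimension of [T @` V] in the closure of
    [T @` X]. It follows from the fact that an injective bounded operator with
    dense range preserves the Hilbert dimension.

    Suppose that [B] is a norm limit of operators [A \o G]. Then [B] and
    [A \o G] are bounded below on the same subspaces when they are close
    enough, with images of the same codimension ([hdim_perturb]), and so are
    their adjoints. As [G] is invertible, [A \o G] has the range of [A] and a
    kernel of the same dimension. Comparing codimensions for [A \o G] and for
    [B] gives both inequalities between [iota_i B] and the sum on the right
    ([orbit_closure_index]).

    Suppose conversely that [BB*] is a limit of operators dominated by [AA*].
    Spectral subspaces of [AA*] and of a compression of [BB*] give a closed
    subspace [W] of the range of [A] such that [B*] is bounded below on [W]
    and small on the complement of [W] ([dominated_cut]). Let [V] be the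
    preimage of [W] in the complement of the kernel of [A]. One can solve
    [A (G x) = proj W (B x)] with [G x] in [V]; this defines [G] outside the
    kernel [N] of [proj W \o B], and there remains to map [N] isomorphically
    onto the complement of [V], by a small multiple of an isometry. This is
    possible as soon as these two spaces have the same dimension, and
    [index_complement] derives this from the index formula. Cancellation, which
    is not available for infinite cardinals, is replaced there by the fact that
    [IC] is either zero or infinite ([IC_absorbing]), hence disappears from any
    sum with a larger cardinal.

    The statement on [G \o A] follows by taking adjoints, since [IC] takes the
    same value at the ranges of [B] and of its adjoint ([IC_adjoint]). *)

(** * Cardinal arithmetic *)

Lemma card_le_rel {T U} (A : set T) (B : set U) (r : T -> U -> Prop) :
  (forall x, A x -> exists2 y, B y & r x y) ->
  (forall x x' y, A x -> A x' -> r x y -> r x' y -> x = x') -> A #<= B.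
Proof.
move=> ex inj; apply/card_leP.
have ex' (x : A) : exists y : B, r (val x) (val y).
  have [y By rxy] := ex _ (set_valP x).
  by exists (SigSub (mem_set By)).
have /choice[f rf] := ex'.
have fi : set_inj [set: A] f.
  move=> x x' _ _ fxx'; apply: val_inj.
  apply: (inj _ _ (val (f x)) (set_valP x) (set_valP x') (rf x)).
  by rewrite fxx'; exact: rf.
by apply/injfunPex; exists f.
Qed.

Lemma card_le_relE {T U} (A : set T) (B : set U) : A #<= B ->
  exists r : T -> U -> Prop,
  (forall x, A x -> exists2 y, B y & r x y) /\
  (forall x x' y, A x -> A x' -> r x y -> r x' y -> x = x').
Proof.
move=> /card_leP[f].
exists (fun x y => exists2 a : A, x = val a & y = val (f a)); split.
  move=> x Ax; exists (val (f (SigSub (mem_set Ax)))); first exact: set_valP.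
  by exists (SigSub (mem_set Ax)).
move=> x x' y Ax Ax' [a -> ->] [a' -> /val_inj E]; congr val.
by apply: (@inj _ _ _ f) => //; rewrite in_setT.
Qed.

Lemma card_le_fun {T U} (A : set T) (B : set U) (f : T -> U) :
  (forall x, A x -> B (f x)) ->
  (forall x x', A x -> A x' -> f x = f x' -> x = x') -> A #<= B.
Proof.
move=> AB inj; apply: (@card_le_rel _ _ _ _ (fun x y => y = f x)).
  by move=> x /AB ?; exists (f x).
by move=> x x' y Ax Ax' -> /inj; apply.
Qed.

Lemma cardinal_addE {T U} (A : set T) (B : set U) z :
  cardinal_add A B z <-> match z with inl x => A x | inr y => B y end.
Proof.
split; first by case=> -[x ? <-].
by case: z => x ?; [left|right]; exists x.
Qed.

Lemma le_cardinal_add {T U T' U'}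
    (A : set T) (B : set U) (A' : set T') (B' : set U') :
  A #<= A' -> B #<= B' -> cardinal_add A B #<= cardinal_add A' B'.
Proof.
move=> /card_le_relE[r [r1 r2]] /card_le_relE[s [s1 s2]].
apply: (@card_le_rel _ _ _ _ (fun x y => match x, y with
  | inl a, inl b => r a b | inr a, inr b => s a b | _, _ => False end)).
  move=> [x|x] /cardinal_addE.
    by move=> /r1[y ? ?]; exists (inl y) => //; apply/cardinal_addE.
  by move=> /s1[y ? ?]; exists (inr y) => //; apply/cardinal_addE.
move=> [x|x] [x'|x'] [y|y] //= /cardinal_addE Ax /cardinal_addE Ax' h h'.
  by rewrite (r2 _ _ _ Ax Ax' h h').
by rewrite (s2 _ _ _ Ax Ax' h h').
Qed.

Lemma eq_cardinal_add {T U T' U'}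
    (A : set T) (B : set U) (A' : set T') (B' : set U') :
  A #= A' -> B #= B' -> cardinal_add A B #= cardinal_add A' B'.
Proof.
rewrite !card_eq_le => /andP[? ?] /andP[? ?].
by apply/andP; split; apply: le_cardinal_add.
Qed.

Lemma cardinal_addC_le {T U} (A : set T) (B : set U) :
  cardinal_add A B #<= cardinal_add B A.
Proof.
apply: (@card_le_fun _ _ _ _ (fun z => match z with inl x => inr x | inr x => inl x end)).
  by move=> [x|x] /cardinal_addE ?; apply/cardinal_addE.
by move=> [x|x] [y|y] _ _ //= [->].
Qed.

Lemma cardinal_addC {T U} (A : set T) (B : set U) :
  cardinal_add A B #= cardinal_add B A.
Proof. by rewrite card_eq_le !cardinal_addC_le. Qed.

Lemma cardinal_addA {T U V} (A : set T) (B : set U) (C : set V) :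
  cardinal_add A (cardinal_add B C) #= cardinal_add (cardinal_add A B) C.
Proof.
rewrite card_eq_le; apply/andP; split.
  apply: (@card_le_fun _ _ _ _ (fun z => match z with inl x => inl (inl x)
    | inr (inl y) => inl (inr y) | inr (inr y) => inr y end)).
    move=> [x|[y|z]] /cardinal_addE /= h; apply/cardinal_addE => //=.
    - by apply/cardinal_addE.
    - by move: h => /cardinal_addE /= h; apply/cardinal_addE.
    - by move: h => /cardinal_addE.
  by move=> [x|[y|z]] [x'|[y'|z']] _ _ //= [->].
apply: (@card_le_fun _ _ _ _ (fun z => match z with inl (inl x) => inl x
    | inl (inr y) => inr (inl y) | inr y => inr (inr y) end)).
  move=> [[x|y]|z] /cardinal_addE /= h; apply/cardinal_addE => //=.
  - by move: h => /cardinal_addE.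
  - by move: h => /cardinal_addE /= h; apply/cardinal_addE.
  - by apply/cardinal_addE.
by move=> [[x|y]|z] [[x'|y']|z'] _ _ //= [->].
Qed.

Lemma le_cardinal_addl {T U} (A : set T) (B : set U) : A #<= cardinal_add A B.
Proof.
apply: (@card_le_fun _ _ _ _ inl); first by move=> x ?; apply/cardinal_addE.
by move=> x y _ _ [].
Qed.

Lemma cardinal_add0 {T U} (A : set T) : cardinal_add (@set0 U) A #= A.
Proof.
rewrite card_eq_le; apply/andP; split.
  apply: (@card_le_rel _ _ _ _ (fun z x => z = inr x)).
    by move=> [x|x] /cardinal_addE //= Ax; exists x.
  by move=> x x' y _ _ -> ->.
by apply: card_le_trans (cardinal_addC_le _ _); apply: le_cardinal_addl.
Qed.

(** A maximal family of disjoint injective sequences in an infinite set misses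
    only finitely many of its points, which one sequence of the family can
    absorb; each sequence is a copy of [nat], hence of [nat * nat]. *)
Lemma infinite_set_mul_nat {T} (I : set T) :
  infinite_set I -> I `*` [set: nat] #<= I.
Proof.
move=> infI.
pose P (S : set (nat -> T)) :=
  (forall f, S f -> injective f /\ forall n, I (f n)) /\
  (forall f g m n, S f -> S g -> f m = g n -> f = g).
have [|S [[Sinj Sdisj] Smax]] := @Zorn_bigcup _ P.
  move=> F FP Ftot; split.
    by move=> f [X FX Xf]; exact: (FP _ FX).1.
  move=> f g m n [X FX Xf] [Y FY Yg] fg.
  have [XY|YX] := Ftot _ _ FX FY.
    by apply: ((FP _ FY).2 _ _ m n) => //; exact: XY.
  by apply: ((FP _ FX).2 _ _ m n) => //; exact: YX.
pose D := [set i | I i /\ forall f n, S f -> f n <> i].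
have finD : finite_set D.
  apply: contrapT => /infiniteP /card_le_relE[r [r1 r2]].
  have /choice[h hP] (n : nat) : exists i, D i /\ r n i.
    by have [i ? ?] := r1 n Logic.I; exists i.
  apply: (Smax (S `|` [set h])).
    split; first by move=> f; left.
    move=> /(_ h (or_intror erefl)) Sh.
    by have [[_ /(_ h 0%N Sh)]] := hP 0%N.
  split.
    move=> f [/Sinj//|->]; split; last by move=> n; have [[]] := hP n.
    move=> m n hmn; apply: (r2 _ _ (h m)) => //; first by have [] := hP m.
    by rewrite hmn; have [] := hP n.
  move=> f g m n [Sf|->] [Sg|->] // E; first exact: (Sdisj _ _ _ _ Sf Sg E).
    by have [[_ /(_ _ m Sf) /(_ E)]] := hP n.
  by have [[_ /(_ _ n Sg) /(_ (esym E))]] := hP m.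
have [f0 Sf0] : exists f0, S f0.
  apply: contrapT => noS; apply: infI; apply: sub_finite_set finD => i Ii.
  by split=> // f n Sf; case: noS; exists f.
have /countable_injP[code codeI] := finite_set_countable finD.
apply: (@card_le_rel _ _ _ _ (fun p j =>
  (exists f m, [/\ S f, p.1 = f m & j = f (pickle (m, p.2, true))]) \/
  (D p.1 /\ j = f0 (pickle (code p.1, p.2, false))))).
  move=> [i n] [/= Ii _].
  have [Di|nDi] := pselect (D i).
    by exists (f0 (pickle (code i, n, false))); [exact: (Sinj _ Sf0).2|right].
  have [f [m [Sf fm]]] : exists f m, S f /\ f m = i.
    apply: contrapT => noS; apply: nDi; split=> // f m Sf fm.
    by apply: noS; exists f, m.
  exists (f (pickle (m, n, true))); first exact: (Sinj _ Sf).2.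
  by left; exists f, m.
have pinj := pcan_inj (@pickleK (nat * nat * bool)%type).
move=> [i n] [i' n'] j _ _ /= [[f [m [Sf -> ->]]]|[Di ->]]
    [[f' [m' [Sf' -> E]]]|[Di' E]].
- have ff' := Sdisj _ _ _ _ Sf Sf' E; rewrite -ff' in E *.
  by move: E => /(Sinj _ Sf).1 /pinj[-> ->].
- have ff' := Sdisj _ _ _ _ Sf Sf0 E; rewrite -ff' in E.
  by move: E => /(Sinj _ Sf).1 /pinj[].
- have ff' := Sdisj _ _ _ _ Sf0 Sf' E; rewrite -ff' in E.
  by move: E => /(Sinj _ Sf0).1 /pinj[].
- move: E => /(Sinj _ Sf0).1 /pinj[Ec ->].
  by congr (_, _); apply: codeI => //; rewrite inE.
Qed.

(** The property of a cardinal that makes it disappear from sums with larger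
    ones; it is what makes cancellation possible in index formulas. *)
Definition absorbing {T} (A : set T) := A = set0 \/ infinite_set A.

Lemma card_le_infinite {T U} (A : set T) (B : set U) :
  A #<= B -> infinite_set A -> infinite_set B.
Proof. by move=> AB /infiniteP nA; apply/infiniteP; exact: card_le_trans AB. Qed.

Lemma cardinal_add_absorb {T U} (A : set T) (B : set U) :
  absorbing A -> A #<= B -> cardinal_add A B #= B.
Proof.
move=> [->|infA] AB; first exact: cardinal_add0.
rewrite card_eq_le; apply/andP; split; last first.
  by apply: card_le_trans (cardinal_addC_le _ _); apply: le_cardinal_addl.
have BnatB := infinite_set_mul_nat (card_le_infinite AB infA).
apply: card_le_trans BnatB.
have ABB := le_cardinal_add AB (card_lexx B).
apply: (card_le_trans ABB).
apply: (@card_le_fun _ _ _ _ (fun z => match z with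
  | inl x => (x, 0%N) | inr x => (x, 1%N) end)).
  by move=> [x|x] /cardinal_addE.
by move=> [x|x] [y|y] _ _ //= [->].
Qed.

(** Cardinals are well ordered (Honig): a maximal set of choice functions that
    differ at every index has, at some index, all the values possible. *)
Lemma card_le_min {T} (F : set (set T)) : F !=set0 ->
  exists2 A, F A & forall B, F B -> A #<= B.
Proof.
move=> [A0 FA0]; apply: contrapT => nomin.
pose P (S : set (set T -> T)) :=
  (forall f B, S f -> F B -> B (f B)) /\
  (forall f g B, S f -> S g -> F B -> f B = g B -> f = g).
have [|S [[Sval Sinj] Smax]] := @Zorn_bigcup _ P.
  move=> G GP Gtot; split; first by move=> f B [X GX Xf]; exact: ((GP _ GX).1 f B Xf).
  move=> f g B [X GX Xf] [Y GY Yg] FB fg.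
  have [XY|YX] := Gtot _ _ GX GY.
    by apply: ((GP _ GY).2 _ _ B) => //; exact: XY.
  by apply: ((GP _ GX).2 _ _ B) => //; exact: YX.
have miss B : F B -> exists2 b, B b & forall f, S f -> f B <> b.
  move=> FB; apply: contrapT => full; apply: nomin; exists B => // C FC.
  apply: (@card_le_rel _ _ _ _ (fun b c => exists f, [/\ S f, f B = b & f C = c])).
    move=> b Bb.
    have [f [Sf fb]] : exists f, S f /\ f B = b.
      apply: contrapT => nof; apply: full; exists b => // f Sf fb.
      by apply: nof; exists f.
    by exists (f C); [exact: (Sval f C)|exists f].
  move=> b b' c _ _ [f [Sf <- <-]] [g [Sg <- E]].
  by rewrite (Sinj _ _ _ Sg Sf FC E).
have [b0 _ _] := miss _ FA0.
have /choice[h hP] B : exists b, F B -> B b /\ forall f, S f -> f B <> b.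
  have [/miss[b ? ?]|nFB] := pselect (F B); first by exists b.
  by exists b0.
apply: (Smax (S `|` [set h])).
  split; first by move=> f; left.
  move=> /(_ h (or_intror erefl)) Sh.
  by have [_ /(_ h Sh)] := hP _ FA0.
split; first by move=> f B [Sf|->]; [exact: (Sval f B)|move=> /hP[]].
move=> f g B [Sf|->] [Sg|->] // FB E; first exact: (Sinj _ _ _ Sf Sg FB E).
  by have [_ /(_ f Sf)/(_ E)] := hP _ FB.
by have [_ /(_ g Sg)/(_ (esym E))] := hP _ FB.
Qed.

(** * Inner products and real-valued norms *)

Local Notation "x %:C" := (real_complex _ x) : ring_scope.

(** Norms are elements of [R[i]]; estimates are carried out with their real
    part, from which they can be recovered by [normE] and [cabsE]. *)
Definition rnorm {R : realType} {V : normedModType R[i]} (x : V) : R :=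
  complex.Re `|x|.

Local Notation nm := rnorm.

Definition cabs {R : realType} (a : R[i]) : R := complex.Re `|a|.

Section inner_product.
Context {R : realType} {H : hilbertType R}.
Implicit Types (x y z : H) (a b : R[i]).


Lemma normE x : `|x| = (nm x)%:C.
Proof.
have := normr_ge0 x; rewrite /rnorm; case: (`|x|) => u v.
by rewrite lecE /= => /andP[/eqP-> _].
Qed.

Lemma cabsE a : `|a| = (cabs a)%:C.
Proof.
have := normr_ge0 a; rewrite /cabs; case: (`|a|) => u v.
by rewrite lecE /= => /andP[/eqP-> _].
Qed.

Lemma rnorm_ge0 x : 0 <= nm x.
Proof. by rewrite -ler0c -normE normr_ge0. Qed.

Lemma dot_self x : hdot x x = (nm x ^+ 2)%:C.
Proof. by rewrite -hdot_norm normE rmorphXn. Qed.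

Lemma dotDl x y z : hdot (x + y) z = hdot x z + hdot y z.
Proof. exact: linearDl. Qed.
Lemma dotDr x y z : hdot x (y + z) = hdot x y + hdot x z.
Proof. exact: linearDr. Qed.
Lemma dotNl x y : hdot (- x) y = - hdot x y.
Proof. exact: linearNl. Qed.
Lemma dotNr x y : hdot x (- y) = - hdot x y.
Proof. exact: linearNr. Qed.
Lemma dotBl x y z : hdot (x - y) z = hdot x z - hdot y z.
Proof. by rewrite dotDl dotNl. Qed.
Lemma dotBr x y z : hdot x (y - z) = hdot x y - hdot x z.
Proof. by rewrite dotDr dotNr. Qed.
Lemma dotZl a x y : hdot (a *: x) y = a * hdot x y.
Proof. exact: linearZl_LR. Qed.
Lemma dotZr a x y : hdot x (a *: y) = a^* * hdot x y.
Proof. exact: linearZr_LR. Qed.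
Lemma dot0l x : hdot 0 x = 0.
Proof. exact: linear0l. Qed.
Lemma dot0r x : hdot x 0 = 0.
Proof. exact: linear0r. Qed.
Lemma dotC x y : hdot x y = (hdot y x)^*.
Proof. by have := hermC (@hdot R H) x y; rewrite expr0 mul1r. Qed.

Lemma dot_eq0C x y : hdot x y = 0 -> hdot y x = 0.
Proof. by rewrite dotC => /(congr1 (@Num.conj _)); rewrite conjCK conjC0. Qed.

Lemma conjCE a : a^* = conjc a.
Proof.
have [->|a0] := eqVneq a 0; first by rewrite conjC0 conjc0.
by apply: (mulfI a0); rewrite -normCK sqr_normc.
Qed.

Lemma Re_conj a : complex.Re a^* = complex.Re a.
Proof. by rewrite conjCE; case: a. Qed.

Lemma ReD a b : complex.Re (a + b) = complex.Re a + complex.Re b.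
Proof. by case: a; case: b. Qed.
Lemma ReN a : complex.Re (- a) = - complex.Re a.
Proof. by case: a. Qed.
Lemma ReZ (r : R) a : complex.Re (r%:C * a) = r * complex.Re a.
Proof. by case: a => u v /=; rewrite mul0r subr0. Qed.

Lemma rnorm_eq0 x : nm x = 0 -> x = 0.
Proof. by move=> x0; apply/eqP; rewrite -normr_eq0 normE x0. Qed.
Lemma rnorm0 : nm (0 : H) = 0.
Proof. by rewrite /rnorm normr0. Qed.
Lemma rnorm_gt0 x : x <> 0 -> 0 < nm x.
Proof.
by move=> x0; rewrite lt_neqAle rnorm_ge0 andbT eq_sym; apply/eqP => /rnorm_eq0.
Qed.
Lemma rnormN x : nm (- x) = nm x.
Proof. by rewrite /rnorm normrN. Qed.
Lemma rnormB x y : nm (x - y) = nm (y - x).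
Proof. by rewrite -rnormN opprB. Qed.
Lemma rnormD x y : nm (x + y) <= nm x + nm y.
Proof.
by have := ler_normD x y; rewrite !normE -rmorphD lecR.
Qed.
Lemma rnorm_triangle z x y : nm (x - y) <= nm (x - z) + nm (z - y).
Proof. by apply: le_trans (rnormD _ _); rewrite addrA subrK. Qed.
Lemma rnormZ a x : nm (a *: x) = cabs a * nm x.
Proof. by apply: complexI; rewrite rmorphM /= -!normE -cabsE normrZ. Qed.
Lemma cabs_real (r : R) : cabs r%:C = `|r|.
Proof. by rewrite /cabs normc_def /= expr0n /= addr0 sqrtr_sqr. Qed.
Lemma cabsM a b : cabs (a * b) = cabs a * cabs b.
Proof. by apply: complexI; rewrite rmorphM /= -!cabsE normrM. Qed.
Lemma rnormZr (r : R) x : nm (r%:C *: x) = `|r| * nm x.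
Proof. by rewrite rnormZ cabs_real. Qed.

Lemma Re_dotC x y : complex.Re (hdot x y) = complex.Re (hdot y x).
Proof. by rewrite dotC Re_conj. Qed.

Lemma rnormD2 x y :
  nm (x + y) ^+ 2 = nm x ^+ 2 + nm y ^+ 2 + 2 * complex.Re (hdot x y).
Proof.
have -> : nm (x + y) ^+ 2 = complex.Re (hdot (x + y) (x + y)) by rewrite dot_self.
by rewrite dotDl !dotDr !ReD !dot_self /= (Re_dotC y x); ring.
Qed.

Lemma rnormB2 x y :
  nm (x - y) ^+ 2 = nm x ^+ 2 + nm y ^+ 2 - 2 * complex.Re (hdot x y).
Proof. by rewrite rnormD2 dotNr ReN rnormN mulrN. Qed.

Lemma parallelogram x y :
  nm (x + y) ^+ 2 + nm (x - y) ^+ 2 = 2 * nm x ^+ 2 + 2 * nm y ^+ 2.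
Proof. by rewrite rnormD2 rnormB2; ring. Qed.

Lemma pythagoras x y :
  hdot x y = 0 -> nm (x + y) ^+ 2 = nm x ^+ 2 + nm y ^+ 2.
Proof. by move=> xy; rewrite rnormD2 xy /= mulr0 addr0. Qed.

Lemma sqr_le (r s : R) : 0 <= s -> r ^+ 2 <= s ^+ 2 -> r <= s.
Proof.
move=> s0 h; have [r0|/ltW r0] := leP 0 r; last exact: le_trans s0.
by rewrite -(@ler_pXn2r _ 2).
Qed.

Lemma rnorm_sqr_dot x : nm x ^+ 2 = complex.Re (hdot x x).
Proof. by rewrite dot_self. Qed.

(** Cauchy-Schwarz, from the component of [x] orthogonal to [y]. *)
Lemma cauchy_schwarz x y : cabs (hdot x y) <= nm x * nm y.
Proof.
have [->|/eqP y0] := eqVneq y 0.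
  by rewrite dot0r rnorm0 mulr0 /cabs normr0.
have ny := rnorm_gt0 y0.
apply: sqr_le; first by rewrite mulr_ge0 ?rnorm_ge0.
set a := hdot x y.
pose c := a * ((nm y ^+ 2)^-1)%:C.
have orth : hdot (x - c *: y) (c *: y) = 0.
  rewrite dotZr dotBl dotZl dot_self -/a /c -[_ * _%:C * _]mulrA -rmorphM mulVf.
    by rewrite mulr1 subrr mulr0.
  by rewrite expf_neq0// gt_eqF.
have := pythagoras orth; rewrite subrK => E.
have : nm (c *: y) ^+ 2 <= nm x ^+ 2 by rewrite E lerDr sqr_ge0.
rewrite rnormZ.
have -> : cabs c = cabs a * (nm y ^+ 2)^-1.
  by rewrite cabsM cabs_real ger0_norm// invr_ge0 sqr_ge0.
have -> : (cabs a * (nm y ^+ 2)^-1 * nm y) ^+ 2 =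
          cabs a ^+ 2 / nm y ^+ 2.
  by field; rewrite gt_eqF.
by rewrite ler_pdivrMr ?exprn_gt0// exprMn.
Qed.

Lemma Re_le_cabs a : complex.Re a <= cabs a.
Proof.
by apply: le_trans (ler_norm _) _; rewrite -lecR -cabsE normc_ge_Re.
Qed.

Lemma Re_dot_le x y : complex.Re (hdot x y) <= nm x * nm y.
Proof. exact: le_trans (Re_le_cabs _) (cauchy_schwarz _ _). Qed.

Lemma dot_inj x y : (forall z, hdot z x = hdot z y) -> x = y.
Proof.
move=> h; apply/eqP; rewrite -subr_eq0; apply/eqP/rnorm_eq0.
apply/eqP; rewrite -sqrf_eq0 rnorm_sqr_dot dotBr h subrr; exact/eqP.
Qed.

Lemma dot_self0 x : hdot x x = 0 -> x = 0.
Proof.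
move=> h; apply: rnorm_eq0; apply/eqP; rewrite -sqrf_eq0 rnorm_sqr_dot h.
exact/eqP.
Qed.

Lemma cabs_eq0 a : cabs a <= 0 -> a = 0.
Proof.
move=> h; apply/eqP; rewrite -normr_eq0 cabsE.
have a0 : 0 <= cabs a by rewrite -ler0c -cabsE normr_ge0.
by rewrite (_ : cabs _ = 0)//; apply/eqP; rewrite eq_le h a0.
Qed.

End inner_product.

(** * Closed subspaces, projections and adjoints *)

Section topology.
Context {R : realType} {H : hilbertType R}.
Implicit Types (x y z : H) (V W : set H).

Lemma gt0_realC (e : R[i]) : 0 < e -> exists2 r : R, 0 < r & e = r%:C.
Proof.
case: e => u v; rewrite ltcE /= => /andP[/eqP-> u0].
by exists u.
Qed.

Lemma nbhs_rnormP x (B : set H) :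
  nbhs x B <-> exists2 e : R, 0 < e & forall y, nm (x - y) < e -> B y.
Proof.
rewrite nbhs_ballP; split.
  move=> [e /gt0_realC[r r0 ->] xB]; exists r => // y xy.
  by apply: xB; rewrite -ball_normE /= normE ltcR.
move=> [e e0 xB]; exists e%:C; first by rewrite /= ltcR.
by move=> y; rewrite -ball_normE /= normE ltcR => /xB.
Qed.

Lemma closureP V x :
  closure V x <-> forall e : R, 0 < e -> exists2 y, V y & nm (x - y) < e.
Proof.
split.
  move=> clx e e0.
  have /clx[y [Vy xy]] : nbhs x [set y | nm (x - y) < e].
    by apply/nbhs_rnormP; exists e.
  by exists y.
move=> h B /nbhs_rnormP[e e0 xB].
by have [y Vy xy] := h _ e0; exists y; split => //; exact: xB.
Qed.

Definition seq_cvg (u : nat -> H) x :=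
  forall e : R, 0 < e -> exists N, forall n, (N <= n)%N -> nm (u n - x) < e.

Definition seq_cauchy (u : nat -> H) :=
  forall e : R, 0 < e -> exists N, forall m n, (N <= m)%N -> (N <= n)%N ->
    nm (u m - u n) < e.

Lemma complete_filter (F : set_system H) :
  ProperFilter F -> cauchy F -> exists x, F --> x.
Proof.
by move=> PF /cauchy_cvg cF; exists (lim F).
Qed.

Lemma seq_cauchy_cvg u : seq_cauchy u -> exists x, seq_cvg u x.
Proof.
move=> cu.
have : cauchy (u @ \oo).
  apply: cauchy_exP => e /gt0_realC[r r0 ->].
  have [N hN] := cu _ r0.
  exists (u N); exists N => // n /= Nn.
  by rewrite -ball_normE /= normE ltcR; apply: hN.
move=> /complete_filter[x ux]; exists x => e e0.
have /ux[N _ hN] : nbhs x [set y | nm (x - y) < e].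
  by apply/nbhs_rnormP; exists e.
by exists N => n Nn; rewrite rnormB; exact: hN.
Qed.

Lemma seq_cvg_closure V u x :
  (forall n, V (u n)) -> seq_cvg u x -> closure V x.
Proof.
move=> Vu ux; apply/closureP => e /ux[N hN].
by exists (u N) => //; rewrite rnormB; apply: hN.
Qed.

Lemma inv_nat_lt (e : R) : 0 < e ->
  exists N, forall n, (N <= n)%N -> n.+1%:R^-1 < e.
Proof.
move=> e0; exists (Num.truncn e^-1) => n Nn.
rewrite invf_plt ?posrE//; apply: lt_le_trans (Num.Theory.truncnS_gt _) _.
by rewrite ler_nat ltnS.
Qed.

Lemma closure_seq V x : closure V x ->
  exists2 u : nat -> H, (forall n, V (u n)) & seq_cvg u x.
Proof.
move=> /closureP clx.
have /choice[u hu] (n : nat) : exists y, V y /\ nm (x - y) < n.+1%:R^-1.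
  by have [|y Vy xy] := clx n.+1%:R^-1; [rewrite invr_gt0|exists y].
exists u; first by move=> n; have [] := hu n.
move=> e /inv_nat_lt[N hN]; exists N => n /hN; rewrite rnormB.
by apply: lt_trans; have [] := hu n.
Qed.

Lemma seq_cvg_cauchy u x : seq_cvg u x -> seq_cauchy u.
Proof.
move=> ux e e0.
have [|N hN] := ux (e / 2); first by rewrite divr_gt0.
exists N => m n /hN hm /hN hn; apply: le_lt_trans (rnorm_triangle x _ _) _.
by rewrite (rnormB x) (splitr e) ltrD.
Qed.

Definition closed_subspace V := linear_subspace V /\ closure V `<=` V.

Lemma subspaceD V x y : linear_subspace V -> V x -> V y -> V (x + y).
Proof. by move=> [_ h] Vx Vy; have := h 1 _ _ Vx Vy; rewrite scale1r. Qed.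
Lemma subspaceZ V (a : R[i]) x : linear_subspace V -> V x -> V (a *: x).
Proof. by move=> [V0 h] Vx; have := h a _ _ Vx V0; rewrite addr0. Qed.
Lemma subspaceN V x : linear_subspace V -> V x -> V (- x).
Proof. by move=> Vs Vx; rewrite -scaleN1r; exact: subspaceZ. Qed.
Lemma subspaceB V x y : linear_subspace V -> V x -> V y -> V (x - y).
Proof. by move=> Vs Vx Vy; apply: subspaceD => //; exact: subspaceN. Qed.

Lemma closure_subspace V : linear_subspace V -> closed_subspace (closure V).
Proof.
move=> Vs; split.
  split; first by apply: subset_closure; case: Vs.
  move=> a x y /closureP cx /closureP cy; apply/closureP => e e0.
  have c0 : 0 < cabs a + 1 by rewrite ltr_wpDl// -ler0c -cabsE normr_ge0.
  have [|x' Vx' xx'] := cx (e / 2 / (cabs a + 1)).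
    by rewrite !divr_gt0.
  have [|y' Vy' yy'] := cy (e / 2); first by rewrite divr_gt0.
  exists (a *: x' + y'); first by case: Vs => _; apply.
  rewrite opprD addrACA -scalerBr; apply: le_lt_trans (rnormD _ _) _.
  rewrite (splitr e) ler_ltD// rnormZ.
  move: xx'; rewrite ltr_pdivlMr// mulrC => /ltW; apply: le_trans.
  by rewrite ler_wpM2r ?rnorm_ge0// lerDl.
move=> x /closureP cx; apply/closureP => e e0.
have [|y /closureP cy xy] := cx (e / 2); first by rewrite divr_gt0.
have [|z Vz yz] := cy (e / 2); first by rewrite divr_gt0.
exists z => //; apply: le_lt_trans (rnorm_triangle y _ _) _.
by rewrite (splitr e) ltrD.
Qed.

Lemma closed_subspace_complete V : closed_subspace V -> complete_set V.
Proof.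
move=> [_ clV] F PF FV cF.
have [x Fx] := complete_filter PF cF.
exists x => //; apply: clV => B /Fx FB.
by have [y []] := filter_ex (filterI FV FB); exists y.
Qed.

Lemma complete_closure V : complete_set V -> closure V `<=` V.
Proof.
move=> cV x clx.
have [u Vu ux] := closure_seq clx.
have cu : cauchy (u @ \oo).
  apply: cauchy_exP => e /gt0_realC[r r0 ->].
  have [N hN] := seq_cvg_cauchy ux r0.
  exists (u N); exists N => // n /= Nn.
  by rewrite -ball_normE /= normE ltcR; apply: hN.
have uV : (u @ \oo) V by exists 0%N => // n _; exact: Vu.
have [y Vy uy] := cV _ _ uV cu.
suff -> : x = y by [].
apply/eqP; rewrite -subr_eq0; apply/eqP/rnorm_eq0/eqP.
rewrite eq_le rnorm_ge0 andbT; apply/ler_addgt0Pr => e e0; rewrite add0r.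
have [|N hN] := ux (e / 2); first by rewrite divr_gt0.
have /uy[N' _ hN'] : nbhs y [set z | nm (y - z) < e / 2].
  by apply/nbhs_rnormP; exists (e / 2) => //; rewrite divr_gt0.
have h1 := hN _ (leq_maxl N N'); have h2 := hN' (maxn N N') (leq_maxr N N').
apply: (le_trans (rnorm_triangle (u (maxn N N')) _ _)).
by rewrite (splitr e) lerD// 1?rnormB ltW.
Qed.

Lemma closed_subspaceI V W :
  closed_subspace V -> closed_subspace W -> closed_subspace (V `&` W).
Proof.
move=> [[V0 Vl] Vc] [[W0 Wl] Wc]; split; first split => //.
  by move=> a x y [Vx Wx] [Vy Wy]; split; [exact: Vl|exact: Wl].
move=> x /closureI[]; by split; [exact: Vc|exact: Wc].
Qed.

Lemma closed_subspaceT : closed_subspace [set: H].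
Proof. by []. Qed.

Definition orth V : set H := [set x | forall y, V y -> hdot x y = 0].

Lemma closed_orth V : closed_subspace (orth V).
Proof.
split; first split.
- by move=> y _; rewrite dot0l.
- move=> a x y hx hy z Vz.
  by rewrite dotDl dotZl hx// hy// mulr0 addr0.
move=> x /closureP cx y Vy; apply: cabs_eq0.
apply/ler_addgt0Pr => e e0; rewrite add0r.
have y0 : 0 < nm y + 1 by rewrite ltr_wpDl// rnorm_ge0.
have [|z oz xz] := cx (e / (nm y + 1)); first by rewrite divr_gt0.
have -> : hdot x y = hdot (x - z) y by rewrite dotBl oz// subr0.
apply: le_trans (cauchy_schwarz _ _) _.
move: xz; rewrite ltr_pdivlMr// => /ltW; apply: le_trans.
by rewrite ler_wpM2l ?rnorm_ge0// lerDl.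
Qed.

Lemma orth_closure V : orth (closure V) = orth V.
Proof.
apply/seteqP; split=> x ox y Vy; first by apply: ox; exact: subset_closure.
apply: dot_eq0C; have [_ cl] := closed_orth [set x].
suff : orth [set x] y by apply.
apply: cl; move: y Vy; apply: closureS => y Vy _ ->.
exact/dot_eq0C/ox.
Qed.

Lemma ominusE V W : ominus V W = V `&` orth W.
Proof. by []. Qed.

Lemma closed_ominus V W : closed_subspace V -> closed_subspace (ominus V W).
Proof. by move=> ?; apply: closed_subspaceI => //; exact: closed_orth. Qed.

(** Nearest point: a minimizing sequence is Cauchy by the parallelogram
    identity. *)
Lemma exists_projection V x : closed_subspace V ->
  exists2 p, V p & orth V (x - p).
Proof.
move=> [Vs Vc].
pose D := [set nm (x - v) ^+ 2 | v in V].
have infD : has_inf D.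
  split; first by exists (nm (x - 0) ^+ 2); exists 0 => //; case: Vs.
  by exists 0 => _ [v _ <-]; rewrite sqr_ge0.
pose d := inf D.
have dle v : V v -> d <= nm (x - v) ^+ 2.
  by move=> Vv; apply: ge_inf; [exact: infD.2|exists v].
have /choice[u hu] (n : nat) : exists v, V v /\ nm (x - v) ^+ 2 < d + n.+1%:R^-1.
  have [|_ [v Vv <-] vd] := @inf_adherent _ D n.+1%:R^-1 _ infD.
    by rewrite invr_gt0.
  by exists v.
have par v w : V v -> V w ->
    nm (v - w) ^+ 2 <= 2 * nm (x - v) ^+ 2 + 2 * nm (x - w) ^+ 2 - 4 * d.
  move=> Vv Vw.
  have := parallelogram (x - v) (x - w).
  have -> : x - v - (x - w) = w - v by rewrite opprB addrC addrA subrK.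
  rewrite (rnormB w) => <-.
  suff : 4 * d <= nm (x - v + (x - w)) ^+ 2 by lra.
  have -> : x - v + (x - w) = 2%:R%:C *: (x - (2^-1)%:C *: (v + w)).
    rewrite scalerBr scalerA -rmorphM divff// rmorph1 scale1r.
    by rewrite rmorph_nat scaler_nat mulr2n addrACA opprD.
  rewrite rnormZr exprMn ger0_norm// -natrX ler_pM2l// dle//.
  by apply: subspaceZ => //; exact: subspaceD.
have cu : seq_cauchy u.
  move=> e e0.
  have [|N hN] := @inv_nat_lt (e ^+ 2 / 4); first by rewrite divr_gt0// exprn_gt0.
  exists N => m n Nm Nn; rewrite -(@ltr_pXn2r _ 2)// ?nnegrE ?rnorm_ge0 ?ltW//.
  have [Vm hm] := hu m; have [Vn hn] := hu n.
  apply: le_lt_trans (par _ _ Vm Vn) _.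
  move: (hN _ Nm) (hN _ Nn) hm hn.
  move: (m.+1%:R^-1) (n.+1%:R^-1) (nm (x - u m) ^+ 2) (nm (x - u n) ^+ 2).
  by move: (e ^+ 2) => *; lra.
have [p up] := seq_cauchy_cvg cu.
have Vp : V p by apply/Vc/(seq_cvg_closure _ up) => n; have [] := hu n.
have pd : nm (x - p) ^+ 2 <= d.
  set r := Num.sqrt d.
  have d0 : 0 <= d by apply: lb_le_inf; [exact: infD.1|move=> _ [v _ <-]; rewrite sqr_ge0].
  have rd : r ^+ 2 = d by rewrite sqr_sqrtr.
  have r0 : 0 <= r by exact: sqrtr_ge0.
  suff : nm (x - p) <= r.
    by move=> h; rewrite -rd ler_pXn2r ?nnegrE ?rnorm_ge0.
  apply/ler_addgt0Pr => e' e'0.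
  have [N1 h1] := up (e' / 2) (divr_gt0 e'0 (ltr0Sn _ 1)).
  have [|N2 h2] := @inv_nat_lt ((e' / 2) ^+ 2); first by rewrite exprn_gt0// divr_gt0.
  pose n := maxn N1 N2.
  have {h1}h1 := h1 n (leq_maxl _ _); have {h2}h2 := h2 n (leq_maxr _ _).
  have [_ hn] := hu n.
  apply: le_trans (rnorm_triangle (u n) _ _) _.
  have : nm (x - u n) <= r + e' / 2.
    apply: sqr_le; first by rewrite addr_ge0// divr_ge0// ltW.
    have : 0 <= r * (e' / 2) by rewrite mulr_ge0// divr_ge0// ltW.
    rewrite sqrrD rd; move: h2 hn; move: (n.+1%:R^-1) (nm (x - u n) ^+ 2).
    by move: ((e' / 2) ^+ 2) (r * (e' / 2)) => *; lra.
  by move: h1; lra.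
exists p => // v Vv.
have [->|/eqP v0] := eqVneq v 0; first by rewrite dot0r.
have nv := rnorm_gt0 v0.
set a := hdot (x - p) v.
pose c := a * ((nm v ^+ 2)^-1)%:C.
have o : hdot (x - p - c *: v) (c *: v) = 0.
  rewrite dotZr dotBl dotZl dot_self -/a /c -[_ * _%:C * _]mulrA -rmorphM mulVf.
    by rewrite mulr1 subrr mulr0.
  by rewrite expf_neq0// gt_eqF.
have := pythagoras o; rewrite subrK => E.
have : d <= nm (x - p - c *: v) ^+ 2.
  by rewrite -addrA -opprD; apply: dle; apply: subspaceD => //; exact: subspaceZ.
move=> h; have : nm (c *: v) ^+ 2 <= 0.
  move: pd h; rewrite E; move: (nm _ ^+ 2) (nm (c *: v) ^+ 2) => s t *; lra.
rewrite rnormZ => h2.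
have : cabs c * nm v <= 0 by apply: sqr_le => //; rewrite expr0n.
rewrite pmulr_lle0// => /cabs_eq0 /eqP; rewrite mulf_eq0 => /orP[/eqP//|].
by move=> /eqP/(congr1 (@complex.Re R)) /= /eqP; rewrite invr_eq0 sqrf_eq0 gt_eqF.
Qed.

Lemma orth_orth V : closed_subspace V -> orth (orth V) = V.
Proof.
move=> Vc; apply/seteqP; split=> x; last by move=> Vx y; move=> /(_ _ Vx)/dot_eq0C.
move=> oox; have [p Vp op] := exists_projection x Vc.
suff : x - p = 0 by move/eqP; rewrite subr_eq0 => /eqP ->.
apply: dot_self0; rewrite dotBr (op _ Vp) subr0.
exact/dot_eq0C/oox.
Qed.

End topology.

Section operators.
Context {R : realType}.
Implicit Types (H K L : hilbertType R).

Lemma mk_op H K (f : H -> K) :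
  (forall (a : R[i]) x y, f (a *: x + y) = a *: f x + f y) ->
  (exists M, forall x, nm (f x) <= M * nm x) ->
  exists T : 'B(H, K), forall x, T x = f x.
Proof.
move=> flin [M fM].
have fb : exists M : R, forall x, `|f x| <= M%:C * `|x|.
  by exists M => x; rewrite !normE -rmorphM lecR.
pose i1 := GRing.isLinear.Build R[i] H K *:%R f flin.
pose i2 := isBoundedOp.Build R H K f fb.
pose T : 'B(H, K) := HB.pack f i1 i2.
by exists T.
Qed.

Lemma op_bound H K (T : 'B(H, K)) :
  exists2 M : R, 0 <= M & forall x, nm (T x) <= M * nm x.
Proof.
have [M hM] := @bounded_op_subproof _ _ _ T.
exists (Num.max M 0); first by rewrite le_max lexx orbT.
move=> x; have := hM x; rewrite !normE -rmorphM lecR => /le_trans; apply.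
by rewrite ler_wpM2r ?rnorm_ge0// le_max lexx.
Qed.

Section linearity.
Context {H K : hilbertType R}.
Variable T : 'B(H, K).
Lemma opD x y : T (x + y) = T x + T y. Proof. exact: linearD. Qed.
Lemma opB x y : T (x - y) = T x - T y. Proof. exact: linearB. Qed.
Lemma opN x : T (- x) = - T x. Proof. exact: linearN. Qed.
Lemma opZ a x : T (a *: x) = a *: T x. Proof. exact: linearZ. Qed.
Lemma op0 : T 0 = 0. Proof. exact: linear0. Qed.
End linearity.

Lemma op_ext H K (S T : 'B(H, K)) : (forall x, S x = T x) -> S = T.
Proof.
move=> ST; have {ST} E : BoundedOp.sort S = BoundedOp.sort T by exact/funext.
case: S T E => [f cf] [g cg] /= fg; subst g.
suff -> : cf = cg by [].
case: cf cg => [[a] [b] [c]] [[a'] [b'] [c']].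
by rewrite (Prop_irrelevance a a') (Prop_irrelevance b b') (Prop_irrelevance c c').
Qed.

Lemma closed_preimage H K (T : 'B(H, K)) (W : set K) :
  closed_subspace W -> closed_subspace (T @^-1` W).
Proof.
move=> [[W0 Wl] Wc]; split; first split.
- by rewrite /= op0.
- by move=> a x y /= Wx Wy; rewrite opD opZ; exact: Wl.
move=> x /closureP cx; apply: Wc; apply/closureP => e e0.
have [M M0 hM] := op_bound T.
have M1 : 0 < M + 1 by rewrite ltr_wpDl.
have [|y Wy xy] := cx (e / (M + 1)); first by rewrite divr_gt0.
exists (T y) => //; rewrite -opB; apply: le_lt_trans (hM _) _.
move: xy; rewrite ltr_pdivlMr// mulrC; apply: le_lt_trans.
by rewrite ler_wpM2r ?rnorm_ge0// lerDl.
Qed.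

Definition ker H K (T : 'B(H, K)) : set H := [set x | T x = 0].

Lemma closed_subspace0 H : closed_subspace [set (0 : H)].
Proof.
split; first by split=> // a x y -> ->; rewrite scaler0 addr0.
move=> x /closureP cx; apply/rnorm_eq0/eqP; rewrite eq_le rnorm_ge0 andbT.
apply/ler_addgt0Pr => e /cx[_ -> ]; rewrite add0r subr0; exact: ltW.
Qed.

Lemma closed_ker H K (T : 'B(H, K)) : closed_subspace (ker T).
Proof. exact: closed_preimage (@closed_subspace0 K). Qed.

Lemma subspace_image H K (T : 'B(H, K)) V :
  linear_subspace V -> linear_subspace (T @` V).
Proof.
move=> [V0 Vl]; split; first by exists 0 => //; exact: op0.
move=> a _ _ [x Vx <-] [y Vy <-]; exists (a *: x + y); first exact: Vl.
by rewrite opD opZ.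
Qed.

Lemma closure_image H K (T : 'B(H, K)) V x :
  closure V x -> closure (T @` V) (T x).
Proof.
move=> cx.
apply/closureP => e e0; move: cx => /closureP cx.
have [M M0 hM] := op_bound T.
have M1 : 0 < M + 1 by rewrite ltr_wpDl.
have [|y Vy xy] := cx (e / (M + 1)); first by rewrite divr_gt0.
exists (T y); first by exists y.
rewrite -opB; apply: le_lt_trans (hM _) _.
move: xy; rewrite ltr_pdivlMr// mulrC; apply: le_lt_trans.
by rewrite ler_wpM2r ?rnorm_ge0// lerDl.
Qed.

(** Riesz representation of [x |-> hdot (T x) y]: a vector orthogonal to the
    kernel, suitably scaled. *)
Lemma riesz_op H K (T : 'B(H, K)) y :
  exists z, forall x, hdot (T x) y = hdot x z.
Proof.
have [ally|/existsNP[u Tuy]] := pselect (forall x, hdot (T x) y = 0).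
  by exists 0 => x; rewrite ally dot0r.
pose N : set H := [set x | hdot (T x) y = 0].
have Nc : closed_subspace N.
  have -> : N = T @^-1` orth [set y].
    by apply/seteqP; split=> x; [move=> h _ -> //|apply].
  by apply: closed_preimage; exact: closed_orth.
have [p Np ow] := exists_projection u Nc.
set w := u - p in ow.
have Tw : hdot (T w) y <> 0 by rewrite /w opB dotBl Np subr0.
set b := hdot (T w) y in Tw.
have b0 : b != 0 by exact/eqP.
have w0 : w <> 0 by move=> w0; apply: Tw; rewrite /b w0 op0 dot0l.
have nw := rnorm_gt0 w0.
exists ((b * ((nm w ^+ 2)^-1)%:C)^* *: w) => x.
have Nx : N (x - (hdot (T x) y / b) *: w).
  by rewrite /N /= opB dotBl opZ dotZl divfK// subrr.
have /dot_eq0C := ow _ Nx; rewrite dotBl dotZl dot_self => /eqP.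
rewrite subr_eq0 => /eqP E.
rewrite dotZr conjCK E.
rewrite mulrACA -rmorphM mulVf; last by rewrite expf_neq0// gt_eqF.
by rewrite rmorph1 mulr1 mulrC divfK.
Qed.

Lemma adjointE H K (T : 'B(H, K)) x y :
  hdot (T x) y = hdot x (adjoint T y).
Proof.
have /choice[f fP] := riesz_op T.
have [S hS] : exists S : 'B(K, H), forall y, S y = f y.
  apply: mk_op.
    move=> a u v; apply: dot_inj => z.
    by rewrite -fP dotDr dotZr !fP dotDr dotZr.
  have [M M0 hM] := op_bound T.
  exists M => y'; have [->|/eqP f0] := eqVneq (f y') 0.
    by rewrite rnorm0 mulr_ge0// rnorm_ge0.
  have f1 := rnorm_gt0 f0.
  rewrite -(ler_pM2l f1) -expr2 rnorm_sqr_dot -fP.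
  apply: le_trans (Re_dot_le _ _) _.
  by rewrite mulrCA mulrA ler_wpM2r ?rnorm_ge0.
have : [set A' : 'B(K, H) | forall x y, hdot (T x) y = hdot x (A' y)] S.
  by move=> x' y'; rewrite hS fP.
by move=> /(xgetI (\0 : 'B(K, H))); apply.
Qed.

Lemma adjointE' H K (T : 'B(H, K)) x y :
  hdot (adjoint T y) x = hdot y (T x).
Proof. by rewrite dotC -adjointE -dotC. Qed.

Lemma adjointK H K (T : 'B(H, K)) : adjoint (adjoint T) = T.
Proof.
by apply: op_ext => x; apply: dot_inj => z; rewrite -adjointE adjointE'.
Qed.

Lemma adjoint_comp H K L (S : 'B(K, L)) (T : 'B(H, K)) x :
  adjoint (S \o T : 'B(H, L)) x = adjoint T (adjoint S x).
Proof. by apply: dot_inj => z; rewrite -!adjointE. Qed.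

Lemma adjoint_bound H K (T : 'B(H, K)) (M : R) : 0 <= M ->
  (forall x, nm (T x) <= M * nm x) -> forall y, nm (adjoint T y) <= M * nm y.
Proof.
move=> M0 hM y; have [->|/eqP f0] := eqVneq (adjoint T y) 0.
  by rewrite rnorm0 mulr_ge0// rnorm_ge0.
rewrite -(ler_pM2l (rnorm_gt0 f0)) -expr2 rnorm_sqr_dot -adjointE.
apply: le_trans (Re_dot_le _ _) _.
by rewrite mulrCA mulrA ler_wpM2r ?rnorm_ge0.
Qed.

Lemma ker_adjoint H K (T : 'B(H, K)) : ker (adjoint T) = orth (range T).
Proof.
apply/seteqP; split=> y.
  by move=> Ty _ [x _ <-]; rewrite -adjointE' Ty dot0l.
by move=> oy; apply: dot_self0; rewrite adjointE' oy.
Qed.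

Lemma closure_range_adjoint H K (T : 'B(H, K)) :
  closure (range (adjoint T)) = orth (ker T).
Proof.
rewrite -[in RHS](adjointK T) ker_adjoint -(orth_closure (range _)) orth_orth//.
by apply: closure_subspace; exact: subspace_image.
Qed.

Lemma closure_range H K (T : 'B(H, K)) :
  closure (range T) = orth (ker (adjoint T)).
Proof. by rewrite -closure_range_adjoint adjointK. Qed.

Lemma closed_closure_range H K (T : 'B(H, K)) :
  closed_subspace (closure (range T)).
Proof. by rewrite closure_range; exact: closed_orth. Qed.

(** The orthogonal projection onto [V], provided that [V] is closed. *)
Definition proj H (V : set H) : 'B(H, H) :=
  xget (\0 : 'B(H, H)) [set P | forall x, V (P x) /\ orth V (x - P x)].

Section proj.
Context {H : hilbertType R} {V : set H}.
Hypothesis Vc : closed_subspace V.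

Lemma projP x : V (proj V x) /\ orth V (x - proj V x).
Proof.
have Vs := Vc.1.
have /choice[f fP] (y : H) : exists p, V p /\ orth V (y - p).
  by have [p ? ?] := exists_projection y Vc; exists p.
have uniq y p : V p -> orth V (y - p) -> f y = p.
  move=> Vp op; have [Vf of_] := fP y.
  have Vfp : V (f y - p) by exact: subspaceB.
  apply/eqP; rewrite -subr_eq0; apply/eqP/dot_self0.
  rewrite {1}(_ : f y - p = (y - p) - (y - f y)).
    by rewrite dotBl op// of_// subrr.
  by rewrite opprB [RHS]addrC addrA subrK.
have [P hP] : exists P : 'B(H, H), forall y, P y = f y.
  apply: mk_op.
    move=> a y z; apply: uniq.
      by apply: subspaceD => //; [apply: subspaceZ => //|]; have [] := fP y; have [] := fP z.
    rewrite opprD addrACA -scalerBr.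
    have oV := (closed_orth V).1.
    apply: (subspaceD oV); first by apply: (subspaceZ _ oV); have [] := fP y.
    by have [] := fP z.
  exists 1 => y; rewrite mul1r; apply: sqr_le; first exact: rnorm_ge0.
  have [Vf of_] := fP y; rewrite -[y in X in _ <= X](subrK (f y)).
  by rewrite pythagoras ?lerDr ?sqr_ge0// of_.
have : [set P : 'B(H, H) | forall x, V (P x) /\ orth V (x - P x)] P.
  by move=> y; rewrite hP; exact: fP.
by move=> /(xgetI (\0 : 'B(H, H))); apply.
Qed.

Lemma proj_in x : V (proj V x). Proof. by have [] := projP x. Qed.
Lemma proj_orth x : orth V (x - proj V x). Proof. by have [] := projP x. Qed.

Lemma proj_uniq x p : V p -> orth V (x - p) -> proj V x = p.
Proof.
move=> Vp op; have [Vf of_] := projP x.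
have Vfp : V (proj V x - p) by exact: subspaceB Vc.1 _ _.
apply/eqP; rewrite -subr_eq0; apply/eqP/dot_self0.
rewrite {1}(_ : proj V x - p = (x - p) - (x - proj V x)).
  by rewrite dotBl op// of_// subrr.
by rewrite opprB [RHS]addrC addrA subrK.
Qed.

Lemma proj_id x : V x -> proj V x = x.
Proof. by move=> Vx; apply: proj_uniq => // y _; rewrite subrr dot0l. Qed.

Lemma proj_orth0 x : orth V x -> proj V x = 0.
Proof. by move=> ox; apply: proj_uniq; [exact: Vc.1.1|rewrite subr0]. Qed.

Lemma proj_eq0 x : proj V x = 0 -> orth V x.
Proof. by move=> p0; have := proj_orth x; rewrite p0 subr0. Qed.

Lemma proj_pythagoras x : nm x ^+ 2 = nm (proj V x) ^+ 2 + nm (x - proj V x) ^+ 2.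
Proof.
have := pythagoras (proj_orth x (proj_in x)); rewrite subrK => ->.
by rewrite addrC.
Qed.

Lemma proj_le x : nm (proj V x) <= nm x.
Proof.
by apply: sqr_le; [exact: rnorm_ge0|rewrite (proj_pythagoras x) lerDl sqr_ge0].
Qed.

Lemma projC_le x : nm (x - proj V x) <= nm x.
Proof.
by apply: sqr_le; [exact: rnorm_ge0|rewrite (proj_pythagoras x) lerDr sqr_ge0].
Qed.

Lemma proj_sym x y : hdot (proj V x) y = hdot x (proj V y).
Proof.
have h1 : hdot (proj V x) (y - proj V y) = 0.
  exact/dot_eq0C/(proj_orth y (proj_in x)).
have h2 : hdot (x - proj V x) (proj V y) = 0 by exact: (proj_orth x (proj_in y)).
move: h1 h2; rewrite dotBr dotBl => /eqP; rewrite subr_eq0 => /eqP ->.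
by move=> /eqP; rewrite subr_eq0 => /eqP ->.
Qed.

Lemma adjoint_proj : adjoint (proj V) = proj V.
Proof.
by apply: op_ext => x; apply: dot_inj => z; rewrite -adjointE proj_sym.
Qed.

End proj.

Definition bounded_below H K (T : H -> K) (V : set H) (c : R) :=
  0 < c /\ forall x, V x -> c * nm x <= nm (T x).

(** A Cauchy sequence in the image comes from a Cauchy sequence of [V]. *)
Lemma closed_image H K (T : 'B(H, K)) V c :
  closed_subspace V -> bounded_below T V c -> closed_subspace (T @` V).
Proof.
move=> [Vs Vc] [c0 Tc]; split; first exact: subspace_image.
move=> y cy; have [u Tu uy] := closure_seq cy.
have /choice[v vP] (n : nat) : exists x, V x /\ T x = u n.
  by have [x ? ?] := Tu n; exists x.
have vC : seq_cauchy v.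
  move=> e e0; have [|N hN] := seq_cvg_cauchy uy (e := c * e); first exact: mulr_gt0.
  exists N => m n Nm Nn; rewrite -(ltr_pM2l c0).
  have [Vm Tm] := vP m; have [Vn Tn] := vP n.
  apply: le_lt_trans (Tc _ _) _; first exact: subspaceB.
  by rewrite opB Tm Tn; exact: hN.
have [x vx] := seq_cauchy_cvg vC.
exists x; first by apply/Vc/(seq_cvg_closure _ vx) => n; have [] := vP n.
have [M M0 hM] := op_bound T.
apply/eqP; rewrite -subr_eq0; apply/eqP/rnorm_eq0/eqP.
rewrite eq_le rnorm_ge0 andbT; apply/ler_addgt0Pr => e e0; rewrite add0r.
have M1 : 0 < M + 1 by rewrite ltr_wpDl.
have [|N1 h1] := vx (e / 2 / (M + 1)); first by rewrite !divr_gt0.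
have [|N2 h2] := uy (e / 2); first by rewrite divr_gt0.
pose n := maxn N1 N2.
have {h1}h1 := h1 n (leq_maxl _ _); have {h2}h2 := h2 n (leq_maxr _ _).
apply: le_trans (rnorm_triangle (u n) _ _) _.
have [_ <-] := vP n; rewrite -opB (splitr e) lerD//.
  apply: le_trans (hM _) _; rewrite rnormB.
  move: h1; rewrite ltr_pdivlMr// mulrC => /ltW; apply: le_trans.
  by rewrite ler_wpM2r ?rnorm_ge0// lerDl.
by have [_ ->] := vP n; exact: ltW.
Qed.

Lemma bounded_below_inj H K (T : 'B(H, K)) V c x :
  bounded_below T V c -> V x -> T x = 0 -> x = 0.
Proof.
move=> [c0 Tc] Vx Tx; apply/rnorm_eq0/eqP; rewrite eq_le rnorm_ge0 andbT.
by have := Tc _ Vx; rewrite Tx rnorm0 pmulr_rle0.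
Qed.

(** If [T] is bounded below on [V], so is its adjoint on [T @` V]: test
    [adjoint T (T x)] against [x] itself. *)
Lemma bounded_below_adjoint H K (T : 'B(H, K)) V c :
  bounded_below T V c -> bounded_below (adjoint T) (T @` V) c.
Proof.
move=> [c0 Tc]; split=> // _ [x Vx <-].
have [->|/eqP x0] := eqVneq x 0; first by rewrite !op0 !rnorm0 mulr0.
have nx := rnorm_gt0 x0; rewrite -(ler_pM2r nx).
apply: (@le_trans _ _ (nm (T x) ^+ 2)).
  by rewrite mulrAC expr2 ler_wpM2r ?rnorm_ge0// Tc.
rewrite rnorm_sqr_dot adjointE Re_dotC; exact: Re_dot_le.
Qed.

(** The supremum defining [opnorm] is that of a bounded set, as it is taken for
    a difference of bounded operators. *)
Lemma opnorm_lt H K (S T : 'B(H, K)) (e : R) :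
  opnorm (fun x => S x - T x) < e -> forall x, nm (S x - T x) <= e * nm x.
Proof.
move=> h x.
have [M M0 hM] := op_bound S; have [N N0 hN] := op_bound T.
have b y : nm (S y - T y) <= (M + N) * nm y.
  apply: le_trans (rnormD _ _) _; rewrite rnormN mulrDl; exact: lerD.
have [->|/eqP x0] := eqVneq x 0.
  by rewrite !op0 subrr !rnorm0 mulr0.
have nx := rnorm_gt0 x0.
pose y := ((nm x)^-1)%:C *: x.
have ny : nm y = 1.
  by rewrite /y rnormZr ger0_norm ?mulVf ?gt_eqF// invr_ge0 ltW.
have -> : nm (S x - T x) = nm (S y - T y) * nm x.
  rewrite /y !opZ -scalerBr rnormZr ger0_norm ?invr_ge0 ?ltW//.
  by rewrite mulrAC mulVf ?mul1r// gt_eqF.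
rewrite ler_pM2r//; apply: le_trans (ltW h).
apply: ub_le_sup; last by exists y => //=; rewrite normE ny.
exists (M + N) => _ [z /= z1 <-]; apply: le_trans (b z) _.
rewrite ler_piMr ?addr_ge0//.
by move: z1; rewrite normE -[1]/(1%:C) lecR.
Qed.

Lemma opnorm_le H K (f : H -> K) (e : R) : 0 <= e ->
  (forall x, nm (f x) <= e * nm x) -> opnorm f <= e.
Proof.
move=> e0 h; apply: ge_sup.
  by exists (nm (f 0)); exists 0 => //=; rewrite normr0.
move=> _ [z /= z1 <-]; apply: le_trans (h z) _.
rewrite ler_piMr//.
by move: z1; rewrite normE -[1]/(1%:C) lecR.
Qed.

End operators.

(** * Orthonormal bases and Hilbert dimension *)

Section dimension.
Context {R : realType}.
Implicit Types (H K L : hilbertType R).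

Lemma linear_span_subspace H (E : set H) : linear_subspace (linear_span E).
Proof.
split; first by move=> W [[W0 _] _].
by move=> a x y sx sy W WE; case: (WE) => [[_ Wl] _]; apply: Wl; [exact: sx|exact: sy].
Qed.

Lemma sub_linear_span H (E : set H) : E `<=` linear_span E.
Proof. by move=> x Ex W [_ EW]; exact: EW. Qed.

Lemma linear_span_min H (E W : set H) :
  linear_subspace W -> E `<=` W -> linear_span E `<=` W.
Proof. by move=> Ws EW x; apply. Qed.

Lemma orth_subset H (V W : set H) : V `<=` W -> orth W `<=` orth V.
Proof. by move=> VW x ox y /VW; exact: ox. Qed.

Lemma orth_span H (E : set H) : orth (closure (linear_span E)) = orth E.
Proof.
rewrite orth_closure; apply/seteqP; split.
  by apply: orth_subset; exact: sub_linear_span.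
move=> x ox; have sub : linear_span E `<=` orth [set x].
  apply: linear_span_min; first exact: (closed_orth _).1.
  by move=> z Ez _ ->; apply: dot_eq0C; exact: ox.
by move=> y /sub h; apply: dot_eq0C; exact: h.
Qed.

Lemma onb_sub H (V E : set H) : orthonormal_basis V E -> E `<=` V.
Proof. by move=> [_ <-] x Ex; apply: subset_closure; exact: sub_linear_span. Qed.

Lemma onb_eq0 H (V E : set H) x : orthonormal_basis V E -> V x ->
  (forall e, E e -> hdot x e = 0) -> x = 0.
Proof.
move=> [_ EV] Vx xE; apply: dot_self0.
have : orth E x by [].
by rewrite -orth_span EV; apply.
Qed.

Lemma onb_exists H (V : set H) : closed_subspace V ->
  exists E, orthonormal_basis V E.
Proof.
move=> Vc.
pose P (E : set H) := orthonormal_set E /\ E `<=` V.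
have [|E [[Eon EV] Emax]] := @Zorn_bigcup _ P.
  move=> F FP Ftot; split; last by move=> x [X FX Xx]; exact: (FP _ FX).2 Xx.
  split; first by move=> x [X FX Xx]; exact: ((FP _ FX).1.1 x Xx).
  move=> x y [X FX Xx] [Y FY Yy].
  have [XY|YX] := Ftot _ _ FX FY.
    by apply: (FP _ FY).1.2 => //; exact: XY.
  by apply: (FP _ FX).1.2 => //; exact: YX.
exists E; split=> //.
set W := closure _.
have Wc : closed_subspace W.
  by apply: closure_subspace; exact: linear_span_subspace.
have WV : W `<=` V.
  move=> x Wx; apply: Vc.2; move: x Wx; apply: closureS.
  exact: linear_span_min Vc.1 EV.
apply/seteqP; split => // x Vx; apply: contrapT => nWx.
set w := x - proj W x.
have ow : orth W w := proj_orth Wc x.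
have Vw : V w.
  by apply: subspaceB => //; [exact: Vc.1|apply: WV; exact: proj_in].
have w0 : w <> 0.
  move=> /eqP; rewrite subr_eq0 => /eqP xp; apply: nWx; rewrite xp.
  exact: proj_in.
have nw := rnorm_gt0 w0.
pose e := ((nm w)^-1)%:C *: w.
have e1 : `|e| = 1.
  by rewrite normE rnormZr ger0_norm ?mulVf ?gt_eqF// invr_ge0 ltW.
have oe y : E y -> hdot e y = 0.
  move=> Ey; rewrite dotZl ow ?mulr0//.
  by apply: subset_closure; exact: sub_linear_span.
apply: (Emax (E `|` [set e])).
  split; first by move=> y; left.
  move=> /(_ e (or_intror erefl)) Ee; have := oe _ Ee.
  by rewrite -hdot_norm e1 expr1n => /eqP; rewrite oner_eq0.
split; last by move=> y [/EV//|->]; apply: subspaceZ => //; exact: Vc.1.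
split; first by move=> y [/Eon.1//|->].
move=> y z [Ey|->] [Ez|->] // yz; first exact: Eon.2.
  exact/dot_eq0C/oe.
exact: oe.
Qed.

Lemma hdimP H (V : set H) : closed_subspace V -> orthonormal_basis V (hdim V).
Proof.
move=> /onb_exists[E EV].
have : [set E | orthonormal_basis V E] E by [].
by move=> /(xgetI set0).
Qed.

(** Bessel's inequality, summed along an orthonormal sequence. *)
Lemma bessel_seq H (u : nat -> H) y (d : R) :
  (forall n, `|u n| = 1) -> (forall m n, m <> n -> hdot (u m) (u n) = 0) ->
  (forall n, d <= cabs (hdot y (u n)) ^+ 2) ->
  forall n : nat, d *+ n <= nm y ^+ 2.
Proof.
move=> u1 uo du n.
suff [s [so sn]] : exists s, (forall m, (n <= m)%N -> hdot s (u m) = 0) /\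
    nm (y - s) ^+ 2 + d *+ n <= nm y ^+ 2.
  by apply: le_trans sn; rewrite lerDr sqr_ge0.
elim: n => [|n [s [so sn]]].
  by exists 0; split=> [m _|]; rewrite ?dot0l// subr0 mulr0n addr0.
pose a := hdot y (u n).
exists (s + a *: u n); split.
  move=> m nm_; rewrite dotDl dotZl so ?(ltnW nm_)// uo ?mulr0 ?addr0//.
  by move=> nE; rewrite nE ltnn in nm_.
apply: le_trans sn; rewrite opprD addrA.
have un1 : hdot (u n) (u n) = 1 by rewrite -hdot_norm u1 expr1n.
have o : hdot (y - s - a *: u n) (a *: u n) = 0.
  by rewrite dotZr !dotBl dotZl so// un1 subr0 mulr1 subrr mulr0.
have := pythagoras o; rewrite subrK => ->.
rewrite mulrS addrA lerD2r lerD2l rnormZ.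
have -> : nm (u n) = 1 by rewrite /rnorm u1.
by rewrite mulr1; exact: du.
Qed.

Lemma countable_nonorthogonal H (E : set H) y : orthonormal_set E ->
  countable [set e | E e /\ hdot y e <> 0].
Proof.
move=> [E1 Eo].
pose F k := [set e | E e /\ k.+1%:R^-1 <= cabs (hdot y e) ^+ 2].
apply: (@sub_countable _ _ _ (\bigcup_(k in [set: nat]) F k)).
  apply: subset_card_le => e [Ee ne].
  have c0 : 0 < cabs (hdot y e) ^+ 2.
    rewrite exprn_gt0// lt_neqAle -ler0c -cabsE normr_ge0 andbT eq_sym.
    by apply/eqP => h; apply: ne; apply: cabs_eq0; rewrite h.
  have [N hN] := inv_nat_lt c0.
  by exists N => //; split=> //; apply/ltW/hN.
apply: bigcup_countable; first exact: countableP.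
move=> k _; apply: finite_set_countable.
apply: contrapT => /infiniteP /card_le_relE[r [r1 r2]].
have /choice[u uP] (n : nat) : exists e, F k e /\ r n e.
  by have [e ? ?] := r1 n Logic.I; exists e.
have u1 n : `|u n| = 1 by have [[/E1]] := uP n.
have uo m n : m <> n -> hdot (u m) (u n) = 0.
  move=> mn; have [[Em _] rm] := uP m; have [[En _] rn] := uP n.
  apply: Eo => // umn; apply: mn; apply: (r2 _ _ (u m)) => //.
  by rewrite umn.
have du n : k.+1%:R^-1 <= cabs (hdot y (u n)) ^+ 2 by have [[]] := uP n.
have := bessel_seq u1 uo du (Num.truncn (nm y ^+ 2 * k.+1%:R)).+1.
apply/negP; rewrite -ltNge -[_ *+ _]mulr_natl ltr_pdivlMr//.
exact: Num.Theory.truncnS_gt.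
Qed.

(** An injective bounded operator cannot lower the dimension. For finite
    dimension this is linear algebra; for infinite dimension each vector of the
    target basis meets the image of only countably many vectors of the source
    basis. *)
Lemma onb_card_le H K (V E : set H) (W F : set K) (T : 'B(H, K)) :
  orthonormal_basis V E -> orthonormal_basis W F ->
  linear_subspace V ->
  (forall x, V x -> W (T x)) -> (forall x, V x -> T x = 0 -> x = 0) ->
  E #<= F.
Proof.
move=> Eb Fb Vs TVW Tinj.
have EV := onb_sub Eb; have [[E1 Eo] _] := Eb.
have neq0 e : E e -> e <> 0.
  by move=> Ee e0; have := E1 _ Ee; rewrite e0 normr0 => /esym/eqP; rewrite oner_eq0.
have [[n Fn]|Finf] := pselect (finite_set F); last first.
  apply: card_le_trans (infinite_set_mul_nat Finf).
  have ctbl f : exists c : H -> nat,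
      {in [set e | E e /\ hdot (adjoint T f) e <> 0] &, injective c}.
    exact/countable_injP/countable_nonorthogonal.
  have [c cP] := choice ctbl.
  apply: (@card_le_rel _ _ _ _ (fun e p => hdot (T e) p.1 <> 0 /\ p.2 = c p.1 e)).
    move=> e Ee.
    have [f [Ff ef]] : exists f, F f /\ hdot (T e) f <> 0.
      apply: contrapT => nf; apply: (neq0 e Ee); apply: Tinj; first exact: EV.
      apply: (onb_eq0 Fb); first exact/TVW/EV.
      by move=> f Ff; apply: contrapT => ef; apply: nf; exists f.
    by exists (f, c f e).
  move=> e e' [f k] Ee Ee' /= [ef ->] [ef' ck].
  by apply: (cP f) => //; rewrite inE; split=> //; rewrite adjointE' => /dot_eq0C.
apply: contrapT => nEF.
have : `I_n.+1 #<= E.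
  have [[m Em]|Einf] := pselect (finite_set E); last first.
    move: Einf => /infiniteP; apply: card_le_trans.
    exact: card_leT.
  have Em' : `I_m #<= E by move: Em; rewrite card_eq_le => /andP[].
  apply: card_le_trans Em'; rewrite card_le_II ltnNge; apply/negP => mn.
  apply: nEF; rewrite (card_le_eql Em) (card_le_eqr Fn).
  by rewrite card_le_II.
move=> /card_le_relE[r [r1 r2]].
have /choice[u uP] (i : 'I_n.+1) : exists e, E e /\ r i e.
  by have [e ? ?] := r1 i (ltn_ord i); exists e.
have [f fP] : exists f : 'I_n -> K, forall y, F y -> exists i, f i = y.
  have : F #<= `I_n by move: Fn; rewrite card_eq_le => /andP[].
  move=> /card_le_relE[s [s1 s2]].
  exists (fun i => xget 0 [set y | F y /\ s y i]) => y Fy.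
  have [i /= iltn syi] := s1 _ Fy.
  exists (Ordinal iltn); case: xgetP; last by move=> /(_ y); case.
  by move=> z _ [Fz szi]; exact: s2 szi syi.
pose M := \matrix_(i < n.+1, j < n) hdot (T (u i)) (f j).
have [i0 [j0 v0]] : exists i, exists j, kermx M i j != 0.
  apply: contrapT => nv.
  have : kermx M == 0.
    apply/eqP/matrixP => i j; rewrite [RHS]mxE; apply/eqP; apply: contrapT => /negP nz.
    by apply: nv; exists i, j.
  rewrite kermx_eq0 /row_free => /eqP rM.
  by have := rank_leq_col M; rewrite rM ltnn.
pose v := row i0 (kermx M).
have vM : v *m M = 0 by rewrite -row_mul mulmx_ker row0.
pose x := \sum_i v 0 i *: u i.
have uV i : V (u i) by apply: EV; have [] := uP i.
have Vx : V x.
  rewrite /x; elim/big_ind: _ => //; first by case: Vs.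
    by move=> a b; exact: subspaceD.
  by move=> i _; exact: subspaceZ.
have sumdot (L : hilbertType R) (g : 'I_n.+1 -> L) z :
    hdot (\sum_i v 0 i *: g i) z = \sum_i v 0 i * hdot (g i) z.
  elim/big_ind2: _ => //; first by rewrite dot0l.
    by move=> a b c d <- <-; rewrite dotDl.
  by move=> i _; rewrite dotZl.
have Tx : T x = 0.
  apply: (onb_eq0 Fb); first exact: TVW.
  move=> y /fP[j <-].
  have -> : T x = \sum_i v 0 i *: T (u i).
    rewrite /x; elim/big_ind2: _ => //; first by rewrite op0.
      by move=> a b c d <- <-; rewrite opD.
    by move=> i _; rewrite opZ.
  rewrite sumdot; have /matrixP/(_ 0 j) := vM; rewrite [LHS]mxE [RHS]mxE => vMj.
  by rewrite -[RHS]vMj; apply: eq_bigr => i _; rewrite [M _ _]mxE.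
have x0 := Tinj _ Vx Tx.
have : hdot x (u j0) = 0 by rewrite x0 dot0l.
rewrite sumdot (bigD1 j0)//= big1 ?addr0.
  have [Ej _] := uP j0.
  rewrite -hdot_norm E1// expr1n mulr1 mxE => h.
  by rewrite h eqxx in v0.
move=> i ij; have [Ei ri] := uP i; have [Ej rj] := uP j0.
rewrite Eo ?mulr0// => uij; move/eqP: ij; apply; apply: val_inj.
by apply: (r2 _ _ (u i)) => //=; rewrite uij.
Qed.

Lemma hdim_le_inj H K (V : set H) (W : set K) (T : 'B(H, K)) :
  closed_subspace V -> closed_subspace W ->
  (forall x, V x -> W (T x)) -> (forall x, V x -> T x = 0 -> x = 0) ->
  hdim V #<= hdim W.
Proof.
by move=> Vc Wc; apply: onb_card_le; [exact: hdimP|exact: hdimP|exact: Vc.1].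
Qed.

(** The adjoint of an operator with dense range is injective. *)
Lemma hdim_le_dense H K (V : set H) (W : set K) (T : 'B(H, K)) :
  closed_subspace V -> closed_subspace W ->
  W `<=` closure (T @` V) -> hdim W #<= hdim V.
Proof.
move=> Vc Wc dense.
apply: (@hdim_le_inj _ _ _ _ (proj V \o adjoint T : 'B(K, H))) => //=.
  by move=> y _; exact: proj_in.
move=> y Wy /(proj_eq0 Vc) oy; apply: dot_self0.
have : orth (T @` V) y by move=> _ [x Vx <-]; rewrite -adjointE' oy.
by rewrite -orth_closure; apply; exact: dense.
Qed.

Lemma eq_hdim H K (V : set H) (W : set K) (T : 'B(H, K)) :
  closed_subspace V -> closed_subspace W ->
  (forall x, V x -> W (T x)) -> (forall x, V x -> T x = 0 -> x = 0) ->
  W `<=` closure (T @` V) -> hdim V #= hdim W.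
Proof.
move=> Vc Wc TVW Tinj dense.
by rewrite card_eq_le (hdim_le_inj Vc Wc TVW Tinj) (hdim_le_dense Vc Wc dense).
Qed.

Lemma onb_card_eq H (V E F : set H) : closed_subspace V ->
  orthonormal_basis V E -> orthonormal_basis V F -> E #= F.
Proof.
move=> Vc Eb Fb; rewrite card_eq_le.
have [I hI] : exists I : 'B(H, H), forall x, I x = x.
  by apply: mk_op => //; exists 1 => x; rewrite mul1r.
by apply/andP; split; [apply: (onb_card_le (T := I) Eb Fb)|
  apply: (onb_card_le (T := I) Fb Eb)]; try exact: Vc.1; move=> x; rewrite hI.
Qed.

(** The union of bases of [V] and of its complement is a basis of [Z], and any
    two bases of [Z] have the same cardinal. *)
Lemma hdim_ominus H (V Z : set H) :
  closed_subspace V -> closed_subspace Z -> V `<=` Z ->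
  hdim Z #= cardinal_add (hdim V) (hdim (ominus Z V)).
Proof.
move=> Vc Zc VZ.
have Wc := closed_ominus V Zc; set W := ominus Z V in Wc *.
have Eb := hdimP Vc; have Fb := hdimP Wc.
set E := hdim V in Eb *; set F := hdim W in Fb *.
have EV := onb_sub Eb; have FW := onb_sub Fb.
have [[E1 Eo] Es] := Eb; have [[F1 Fo] Fs] := Fb.
have EF e f : E e -> F f -> hdot e f = 0.
  by move=> /EV Ve /FW[_ of_]; exact/dot_eq0C/of_.
have b : orthonormal_basis Z (E `|` F).
  split; first split.
  - by move=> x [/E1|/F1].
  - move=> x y [Ex|Fx] [Ey|Fy] xy; [exact: Eo|exact: EF| |exact: Fo].
    exact/dot_eq0C/EF.
  - apply/seteqP; split.
      move=> x cx; apply: Zc.2; move: x cx; apply: closureS.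
      by apply: linear_span_min Zc.1 _ => x [/EV/VZ//|/FW[]].
    move=> z Zz; rewrite -(subrK (proj V z) z).
    have sub A : A `<=` E `|` F ->
        closure (linear_span A) `<=` closure (linear_span (E `|` F)).
      move=> AEF; apply: closureS; apply: linear_span_min.
        exact: linear_span_subspace.
      by move=> x /AEF; exact: sub_linear_span.
    have Us : linear_subspace (closure (linear_span (E `|` F))).
      by apply: (closure_subspace _).1; exact: linear_span_subspace.
    apply: (subspaceD Us).
    + apply: (sub F); first by move=> x; right.
      rewrite Fs; split; last exact: proj_orth.
      by apply: subspaceB => //; [exact: Zc.1|apply/VZ/proj_in].
    + apply: (sub E); first by move=> x; left.
      by rewrite Es; exact: proj_in.
rewrite (card_eql (onb_card_eq Zc (hdimP Zc) b)) card_eq_le.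
apply/andP; split.
  apply: (@card_le_rel _ _ _ _ (fun x z => match z with
    inl y => E x /\ x = y | inr y => F x /\ x = y end)).
    move=> x [Ex|Fx].
      by exists (inl x) => //; apply/cardinal_addE.
    by exists (inr x) => //; apply/cardinal_addE.
  by move=> x x' [y|y] _ _ [_ ->] [_ ->].
apply: (@card_le_fun _ _ _ _ (fun z => match z with inl y => y | inr y => y end)).
  by move=> [x|x] /cardinal_addE; [left|right].
have ne e : E e -> F e -> False.
  move=> Ee Fe; have := EF _ _ Ee Fe; rewrite -hdot_norm E1// expr1n => /eqP.
  by rewrite oner_eq0.
move=> [x|x] [y|y] /cardinal_addE /= hx /cardinal_addE /= hy xy.
- by rewrite xy.
- by case: (ne x) => //; rewrite xy.
- by case: (ne x) => //; rewrite xy.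
- by rewrite xy.
Qed.

End dimension.

(** * Codimensions of images *)

Section codimension.
Context {R : realType}.
Implicit Types (H K : hilbertType R).

Lemma proj_orthE H (V : set H) x :
  closed_subspace V -> proj (orth V) x = x - proj V x.
Proof.
move=> Vc; apply: proj_uniq; [exact: closed_orth|exact: proj_orth|].
by rewrite subKr => y; move=> /(_ _ (proj_in Vc x))/dot_eq0C.
Qed.

Lemma sub_proj_ominus H (V Y : set H) y : closed_subspace V ->
  closed_subspace Y -> V `<=` Y -> Y y -> ominus Y V (y - proj V y).
Proof.
move=> Vc Yc VY Yy; split; last exact: proj_orth.
by apply: subspaceB => //; [exact: Yc.1|apply/VY/proj_in].
Qed.

Lemma orth_ominus H (V Y : set H) y : closed_subspace V ->
  closed_subspace Y -> V `<=` Y -> Y y -> orth (ominus Y V) y -> V y.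
Proof.
move=> Vc Yc VY Yy oy.
have q := sub_proj_ominus Vc Yc VY Yy.
have : y - proj V y = 0.
  apply: dot_self0; rewrite dotBl oy// sub0r.
  by rewrite [hdot _ _]dot_eq0C ?oppr0//; apply: q.2; exact: proj_in.
by move=> /eqP; rewrite subr_eq0 => /eqP ->; exact: proj_in.
Qed.

(** Let [Z] be the orthogonal complement of [V] in [X], and [Z0] the part of
    [Z] that [T] sends into [T @` V]. Projecting the kernel of [T] to [Z] is an
    isomorphism onto [Z0], and [T] followed by the projection to the complement
    of [T @` V] is injective with dense range on the rest of [Z]. *)
Lemma codim_image H K (T : 'B(H, K)) (X V : set H) c :
  closed_subspace X -> closed_subspace V -> V `<=` X -> bounded_below T V c ->
  hdim (ominus X V) #=
  cardinal_add (hdim [set x | X x /\ T x = 0])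
               (hdim (ominus (closure (T @` X)) (T @` V))).
Proof.
move=> Xc Vc VX Tbb.
have TVc := closed_image Vc Tbb.
have Yc : closed_subspace (closure (T @` X)).
  by apply: closure_subspace; apply: subspace_image; exact: Xc.1.
set Y := closure _ in Yc *; set V' := T @` V in TVc *.
have TY x : X x -> Y (T x) by move=> Xx; apply: subset_closure; exists x.
have V'Y : V' `<=` Y by move=> _ [v Vv <-]; exact/TY/VX.
have Zc := closed_ominus V Xc; set Z := ominus X V in Zc *.
have Wc := closed_ominus V' Yc; set W := ominus Y V' in Wc *.
set N := [set x | _].
have Nc : closed_subspace N.
  by apply: (closed_subspaceI Xc); exact: closed_ker T.
pose Z0 := Z `&` T @^-1` V'.
have Z0c : closed_subspace Z0 by apply: closed_subspaceI => //; exact: closed_preimage.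
have Z0Z : Z0 `<=` Z by move=> x [].
have oVc := closed_orth V.
have NZ0 : hdim N #= hdim Z0.
  apply: (@eq_hdim _ _ _ _ _ (proj (orth V))) => //.
  - move=> x [Xx Tx]; rewrite proj_orthE//; split.
      exact: sub_proj_ominus.
    rewrite /= opB Tx sub0r -opN; exists (- proj V x) => //.
    by apply: subspaceN; [exact: Vc.1|exact: proj_in].
  - move=> x [Xx Tx]; rewrite proj_orthE// => /eqP; rewrite subr_eq0 => /eqP xp.
    by apply: (bounded_below_inj Tbb) => //; rewrite xp; exact: proj_in.
  - move=> z [[Xz oz] [v Vv Tv]]; apply: subset_closure; exists (z - v).
      split; last by rewrite opB Tv subrr.
      by apply: subspaceB => //; [exact: Xc.1|exact: VX].
    by rewrite proj_orthE// opB (proj_orth0 Vc oz) (proj_id Vc Vv) sub0r opprK subrK.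
have Z1c := closed_ominus Z0 Zc.
have Z1W : hdim (ominus Z Z0) #= hdim W.
  apply: (@eq_hdim _ _ _ _ _ (proj W \o T : 'B(H, K))) => //=.
  - by move=> x _; exact: proj_in.
  - move=> x [[Xx ox] oZ0] /(proj_eq0 Wc) oTx.
    apply: dot_self0; apply: oZ0; split=> //=.
    by apply: orth_ominus oTx => //; exact: TY.
  - move=> w Ww; rewrite -[w](proj_id Wc)//.
    have := closure_image (T := proj W) Ww.1; apply: closureS.
    move=> _ [_ [x Xx <-] <-].
    set z := x - proj V x; have Zz : Z z by exact: sub_proj_ominus.
    exists (z - proj Z0 z); first exact: sub_proj_ominus.
    have V'0 y : V' y -> proj W y = 0.
      by move=> V'y; apply: proj_orth0 => // u [_ ou]; exact/dot_eq0C/ou.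
    have V'1 : V' (T (proj V x)) by exists (proj V x) => //; exact: proj_in.
    have [_ V'2] := proj_in Z0c z.
    rewrite /= (opB T z) (opB (proj W)) (V'0 _ V'2) subr0.
    by rewrite /z (opB T) (opB (proj W)) (V'0 _ V'1) subr0.
apply: card_eq_trans (hdim_ominus Z0c Zc Z0Z) _.
by apply: eq_cardinal_add => //; rewrite card_eq_sym.
Qed.

(** A vector [y] of the left-hand space that projects to zero on the right-hand
    one is some [T v]; being orthogonal to [S v], which is close to [T v], it
    vanishes. *)
Lemma hdim_perturb_le H K (S T : 'B(H, K)) V Y (c d : R) :
  closed_subspace V -> closed_subspace Y -> T @` V `<=` Y ->
  bounded_below T V c -> d < c ->
  (forall v, V v -> nm (S v - T v) <= d * nm v) ->
  hdim (ominus Y (S @` V)) #<= hdim (ominus Y (T @` V)).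
Proof.
move=> Vc Yc TY Tbb dc dST.
have TVc := closed_image Vc Tbb.
have Wc := closed_ominus (T @` V) Yc.
apply: (@hdim_le_inj _ _ _ _ _ (proj (ominus Y (T @` V)))) => //.
- exact: closed_ominus.
- by move=> y _; exact: proj_in.
move=> y [Yy oy] /(proj_eq0 Wc) /(orth_ominus TVc Yc TY Yy) [v Vv Tv].
have [c0 cT] := Tbb.
apply: contrapT => /rnorm_gt0 ny.
have h1 : nm y ^+ 2 <= nm y * (d * nm v).
  have ySv : hdot y (S v) = 0 by apply: oy; exists v.
  have -> : nm y ^+ 2 = complex.Re (hdot y (T v - S v)).
    by rewrite dotBr ySv subr0 Tv rnorm_sqr_dot.
  apply: le_trans (Re_dot_le _ _) _.
  by rewrite ler_wpM2l ?rnorm_ge0// rnormB dST.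
have h2 := cT _ Vv; rewrite Tv in h2.
move: h1; rewrite expr2 ler_pM2l// => h1.
have nv : 0 < nm v.
  by apply: rnorm_gt0 => v0; rewrite -Tv v0 op0 rnorm0 ltxx in ny.
have : c * nm v <= d * nm v by exact: le_trans h2 h1.
by rewrite ler_pM2r// leNgt dc.
Qed.

(** The constant leaves room for using the previous lemma both ways, [S] being
    bounded below by [c - d] only. *)
Lemma hdim_perturb H K (S T : 'B(H, K)) V Y (c d : R) :
  closed_subspace V -> closed_subspace Y -> S @` V `<=` Y -> T @` V `<=` Y ->
  bounded_below T V c -> 2 * d < c ->
  (forall v, V v -> nm (S v - T v) <= d * nm v) ->
  bounded_below S V (c - d) /\
  hdim (ominus Y (S @` V)) #= hdim (ominus Y (T @` V)).
Proof.
move=> Vc Yc SY TY Tbb dc dST.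
(* [d] may be negative when [V] is zero *)
have [[v [Vv v0]]|V0] := pselect (exists v, V v /\ v <> 0); last first.
  have V0' v : V v -> v = 0.
    by move=> Vv; apply: contrapT => v0; apply: V0; exists v.
  have E : S @` V = T @` V.
    by apply/seteqP; split=> _ [v Vv <-]; exists v => //; rewrite (V0' _ Vv) !op0.
  rewrite E; split=> //; split; last first.
    by move=> v Vv; rewrite (V0' _ Vv) op0 !rnorm0 mulr0.
  by have [c0 _] := Tbb; lra.
have d0 : 0 <= d.
  have := le_trans (rnorm_ge0 _) (dST _ Vv); rewrite pmulr_lge0//.
  exact: rnorm_gt0.
have Sbb : bounded_below S V (c - d).
  split; first by have [c0 _] := Tbb; lra.
  move=> x Vx; have := dST _ Vx; have := Tbb.2 _ Vx.
  have : nm (T x) <= nm (S x - T x) + nm (S x).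
    by rewrite -{1}[T x](subKr (S x)) addrC; apply: le_trans (rnormD _ _) _;
      rewrite rnormN addrC.
  by rewrite mulrBl; lra.
split=> //; rewrite card_eq_le; apply/andP; split.
  by apply: (hdim_perturb_le (c := c) (d := d)) => //; lra.
apply: (hdim_perturb_le (c := c - d) (d := d)) => //; first lra.
by move=> x /dST; rewrite rnormB.
Qed.

(** Uniform boundedness by a gliding hump: otherwise unit vectors [u n] of [W]
    with very small [adjoint T (u n)] would allow to build a vector of [W] whose
    inner products with the [u n] decrease too slowly for it to be some [T y]. *)
Lemma adjoint_bounded_below_range H K (T : 'B(H, K)) (W : set K) :
  closed_subspace W -> W `<=` range T ->
  exists c, bounded_below (adjoint T) W c.
Proof.
move=> Wc WT; apply: contrapT => nbb.
pose q (n : nat) : R := 4^-1 ^+ n.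
have q0 n : 0 < q n by rewrite exprn_gt0// invr_gt0.
have qS n : q n.+1 = 4^-1 * q n by rewrite /q exprS.
have /choice[u uP] (n : nat) : exists u, [/\ W u, nm u = 1 &
    nm (adjoint T u) <= q n / n.+1%:R].
  have e0 : 0 < q n / n.+1%:R by rewrite divr_gt0.
  have [w [Ww hw]] : exists w, W w /\ nm (adjoint T w) < q n / n.+1%:R * nm w.
    apply: contrapT => nw; apply: nbb; exists (q n / n.+1%:R); split=> // w Ww.
    by rewrite leNgt; apply/negP => hw; apply: nw; exists w.
  have w0 : 0 < nm w.
    by move: (le_lt_trans (rnorm_ge0 _) hw); rewrite pmulr_rgt0.
  exists (((nm w)^-1)%:C *: w); split.
  - by apply: subspaceZ => //; exact: Wc.1.
  - by rewrite rnormZr ger0_norm ?mulVf ?gt_eqF// invr_ge0 ltW.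
  - have iv : 0 <= (nm w)^-1 by rewrite invr_ge0 ltW.
    by rewrite opZ rnormZr (ger0_norm iv) ler_pdivrMl// mulrC ltW.
(* either [x n] already has a large product with [u n], or [u n] is added *)
pose fix x (n : nat) : K := match n with
  | 0%N => 0
  | n.+1 => if cabs (hdot (x n) (u n)) < q n / 2 then x n + (q n)%:C *: u n else x n
  end.
have xS n : x n.+1 = if cabs (hdot (x n) (u n)) < q n / 2
  then x n + (q n)%:C *: u n else x n by [].
have step n : nm (x n.+1 - x n) <= q n.
  rewrite xS; case: ifP => _; last by rewrite subrr rnorm0 ltW.
  rewrite addrC addKr rnormZr (ger0_norm (ltW (q0 n))).
  by have [_ -> _] := uP n; rewrite mulr1.
have big n : q n / 2 <= cabs (hdot (x n.+1) (u n)).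
  rewrite xS; case: ifP => [small|/negbT]; last by rewrite -leNgt.
  have [_ u1 _] := uP n.
  rewrite dotDl dotZl dot_self u1 expr1n mulr1.
  have tri : q n <= cabs (hdot (x n) (u n) + (q n)%:C) + cabs (hdot (x n) (u n)).
    have E : (q n)%:C = (hdot (x n) (u n) + (q n)%:C) - hdot (x n) (u n).
      by rewrite addrC addKr.
    have := ler_normB (hdot (x n) (u n) + (q n)%:C) (hdot (x n) (u n)).
    rewrite -E !cabsE -rmorphD lecR cabs_real ger0_norm//; exact: ltW.
  by lra.
have tail n k : nm (x (n + k)%N - x n) <= 4 / 3 * (q n - q (n + k)%N).
  elim: k => [|k IH]; first by rewrite addn0 !subrr rnorm0 mulr0.
  apply: le_trans (rnorm_triangle (x (n + k)%N) _ _) _.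
  have := step (n + k)%N; rewrite addnS qS; lra.
have tail' n m : (n <= m)%N -> nm (x m - x n) <= 4 / 3 * q n.
  move=> /subnKC <-; apply: le_trans (tail _ _) _.
  by have := q0 (n + (m - n))%N; lra.
have qlt e : 0 < e -> exists N, q N < e.
  move=> /inv_nat_lt[N hN]; exists N; apply: le_lt_trans (hN _ (leqnn N)).
  rewrite /q exprVn -natrX lef_pV2 ?posrE ?ltr0n ?expn_gt0// ler_nat.
  exact: ltn_expl.
have xc : seq_cauchy x.
  move=> e e0; have [|N hN] := qlt (e / 4); first by rewrite divr_gt0.
  exists N => m n /tail' hm /tail' hn.
  apply: le_lt_trans (rnorm_triangle (x N) _ _) _.
  by rewrite (rnormB (x N)); lra.
have [l xl] := seq_cauchy_cvg xc.
have Wx n : W (x n).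
  elim: n => [|n IH]; first exact: Wc.1.1.
  rewrite xS; case: ifP => // _; apply: subspaceD => //; first exact: Wc.1.
  by apply: subspaceZ; [exact: Wc.1|have [] := uP n].
have Wl : W l by apply/Wc.2/(seq_cvg_closure Wx xl).
have lx n : nm (l - x n) <= 4 / 3 * q n.
  apply/ler_addgt0Pr => e /xl[N hN].
  have := hN _ (leq_maxl N n); have := tail' _ _ (leq_maxr N n).
  have := rnorm_triangle (x (maxn N n)) l (x n); rewrite (rnormB l (x (maxn N n))).
  by lra.
have [y _ yl] := WT _ Wl.
have lu n : q n / 6 <= cabs (hdot l (u n)).
  have [_ u1 _] := uP n.
  have := big n; have := lx n.+1; rewrite qS => h1 h2.
  have h3 := cauchy_schwarz (x n.+1 - l) (u n); rewrite u1 mulr1 rnormB in h3.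
  have h4 : cabs (hdot (x n.+1) (u n)) <=
      cabs (hdot l (u n)) + cabs (hdot (x n.+1 - l) (u n)).
    have := ler_normD (hdot l (u n)) (hdot (x n.+1 - l) (u n)).
    by rewrite -dotDl addrC subrK !cabsE -rmorphD lecR.
  by lra.
have y0 := rnorm_ge0 y.
have [|N /(_ _ (leqnn N)) hN] := @inv_nat_lt R (1 / (6 * (nm y + 1))).
  by rewrite divr_gt0// mulr_gt0// ltr_wpDl.
have [_ _ Tu] := uP N.
have : q N / 6 <= nm y * (q N / N.+1%:R).
  apply: (le_trans (lu N)); rewrite -yl adjointE.
  by apply: le_trans (cauchy_schwarz _ _) _; rewrite ler_wpM2l.
rewrite mulrCA ler_pM2l// leNgt => /negP; apply.
move: hN; rewrite ltr_pdivlMr ?mulr_gt0// ?ltr_wpDl//.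
have : 0 <= N.+1%:R^-1 :> R by rewrite invr_ge0.
by move: (N.+1%:R^-1 : R) => i *; lra.
Qed.

(** Bounded inverse theorem, for a closed subspace of the range. *)
Lemma bounded_below_section H K (T : 'B(H, K)) (W : set K) :
  closed_subspace W -> W `<=` range T ->
  exists V c, [/\ closed_subspace V, V `<=` orth (ker T),
    bounded_below T V c & T @` V = W].
Proof.
move=> Wc WT.
have kc := closed_ker T.
(* the part of the preimage of [W] that is orthogonal to the kernel of [T] *)
pose V := orth (ker T) `&` T @^-1` W.
have Vc : closed_subspace V.
  by apply: closed_subspaceI; [exact: closed_orth|exact: closed_preimage].
have TV : T @` V = W.
  apply/seteqP; split; first by move=> _ [v [_ Wv] <-].
  move=> w Ww; have [y _ yw] := WT _ Ww.
  have Tp : T (y - proj (ker T) y) = w.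
    by rewrite opB yw (proj_in kc y) subr0.
  exists (y - proj (ker T) y) => //; split; first exact: proj_orth.
  by rewrite /= Tp.
pose S : 'B(H, K) := T \o proj V.
have SE v : V v -> S v = T v by move=> Vv; rewrite /S /= proj_id.
have [|c Sbb] := @adjoint_bounded_below_range _ _ S W Wc.
  by rewrite -TV => _ [v Vv <-]; exists v => //; rewrite SE.
have Sc := closed_image Wc Sbb.
have SadjV w : V (adjoint S w).
  by rewrite /S adjoint_comp adjoint_proj//; exact: proj_in.
have Vs v : V v -> (adjoint S @` W) v.
  move=> Vv; set p := proj (adjoint S @` W) v.
  have pS : (adjoint S @` W) p by exact: proj_in.
  have Vp : V p by case: pS => w _ <-.
  have Vq : V (v - p) by apply: subspaceB => //; exact: Vc.1.
  have oq : orth (adjoint S @` W) (v - p) by exact: proj_orth.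
  have Tq : T (v - p) = 0.
    apply: dot_self0; rewrite -{1}SE// adjointE; apply: oq.
    by exists (T (v - p)) => //; case: Vq.
  have : v - p = 0 by apply: dot_self0; case: Vq => + _; apply.
  by move=> /eqP; rewrite subr_eq0 => /eqP ->.
exists V, c; split=> //; first by move=> v [].
have [c0 cS] := Sbb.
split=> // v Vv; have [->|/eqP v0] := eqVneq v 0.
  by rewrite op0 !rnorm0 mulr0.
have nv := rnorm_gt0 v0.
have [w Ww Sw] := Vs _ Vv.
have h1 := cS _ Ww; rewrite Sw in h1.
have h2 : nm v ^+ 2 <= nm (T v) * nm w.
  rewrite rnorm_sqr_dot -{2}Sw -adjointE SE//; exact: Re_dot_le.
rewrite -(ler_pM2r nv) -mulrA -expr2.
apply: (@le_trans _ _ (c * (nm (T v) * nm w))); first by rewrite ler_pM2l.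
by rewrite mulrCA ler_wpM2l ?rnorm_ge0.
Qed.

End codimension.

(** * The incompleteness index *)

Section index.
Context {R : realType}.
Implicit Types (H K : hilbertType R).

(** The cardinals compared in the definition of [IC] have a least element, and
    complete subspaces are the closed ones. *)
Lemma ICP H (E : set H) : linear_subspace E ->
  exists V, [/\ closed_subspace V, V `<=` E,
    IC E = hdim (ominus (closure E) V) &
    forall V', closed_subspace V' -> V' `<=` E ->
      IC E #<= hdim (ominus (closure E) V')].
Proof.
move=> Es.
pose codims := [set c | exists V, [/\ linear_subspace V, complete_set V, V `<=` E
  & c = hdim (ominus (closure E) V)]].
have cl V : closed_subspace V -> V `<=` E -> codims (hdim (ominus (closure E) V)).
  by move=> Vc VE; exists V; split=> //; [exact: Vc.1|exact: closed_subspace_complete].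
have [|c cc cmin] := @card_le_min _ codims.
  exists (hdim (ominus (closure E) [set 0])); apply: cl.
    exact: closed_subspace0.
  by move=> _ ->; exact: Es.1.
have : [set c | codims c /\ forall c', codims c' -> c #<= c'] c by [].
move=> /(xgetI set0); rewrite -[xget _ _]/(IC E) => -[[V [Vs Vc VE ->]] min].
exists V; split=> //; first by split=> //; exact: complete_closure.
by move=> V' V'c V'E; apply: min; exact: cl.
Qed.

Lemma hdim0 H : hdim [set (0 : H)] = set0.
Proof.
have b := hdimP (@closed_subspace0 R H).
apply/seteqP; split=> // e he; have := b.1.1 _ he.
by rewrite (onb_sub b he) normr0 => /esym/eqP; rewrite oner_eq0.
Qed.

Lemma hdim_neq0 H (V : set H) x :
  closed_subspace V -> V x -> x <> 0 -> hdim V !=set0.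
Proof.
move=> Vc Vx x0; have b := hdimP Vc.
apply: contrapT => nE; apply: x0; apply: (onb_eq0 b Vx) => e Ee.
by case: nE; exists e.
Qed.

Lemma finite_cardinal_add_lt {T U} (A : set T) (B : set U) :
  finite_set B -> A !=set0 -> ~ (cardinal_add A B #<= B).
Proof.
move=> [n Bn] [a Aa] le.
have nB : `I_n #<= B by move: Bn; rewrite card_eq_le => /andP[].
have : `I_n.+1 #<= `I_n.
  rewrite -(card_le_eqr Bn); apply: card_le_trans le.
  have [r [r1 r2]] := card_le_relE nB.
  apply: (@card_le_rel _ _ _ _ (fun i z => match z with
    | inl x => i = n /\ x = a | inr y => (i < n)%N /\ r i y end)).
    move=> i /=; rewrite ltnS leq_eqVlt => /orP[/eqP->|iltn].
      by exists (inl a) => //; apply/cardinal_addE.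
    by have [y By ry] := r1 _ iltn; exists (inr y) => //; apply/cardinal_addE.
  by move=> i j [x|y] _ _ [h1 h2] [h3 h4]; [rewrite h1 h3|exact: (r2 _ _ y)].
by rewrite card_le_II ltnn.
Qed.

(** A closed subspace [V] of [E] of finite codimension that is not all of [E]
    is never of minimal codimension: add to it one more vector of [E]. *)
Lemma IC_absorbing H (E : set H) : linear_subspace E -> absorbing (IC E).
Proof.
move=> Es; have [V [Vc VE -> min]] := ICP Es.
have cEc := closure_subspace Es.
have VcE : V `<=` closure E by move=> x /VE; exact: subset_closure.
have [EV|/existsNP[e0 /not_implyP[Ee0 nVe0]]] := pselect (forall x, E x -> V x).
  left; rewrite -[RHS](hdim0 H); congr hdim; apply/seteqP; split=> x; last first.
    by move=> ->; exact: (closed_ominus V cEc).1.1.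
  move=> [cx ox]; apply: dot_self0; apply: ox.
  by apply: Vc.2; move: x cx; exact: closureS.
right => fin.
set e := e0 - proj V e0.
have Ee : E e by apply: subspaceB => //; exact/VE/proj_in.
have oe : orth V e by exact: proj_orth.
have e_neq0 : e <> 0.
  by move=> /eqP; rewrite subr_eq0 => /eqP e0p; apply: nVe0; rewrite e0p; exact: proj_in.
clearbody e.
(* the span of [V] and [e], in a form that makes it closed *)
pose V' := orth (orth V `&` orth [set e]).
have V'c : closed_subspace V' by exact: closed_orth.
have VV' : V `<=` V' by move=> x Vx y [oy _]; exact/dot_eq0C/oy.
have V'e : V' e by move=> y [_ oy]; exact/dot_eq0C/oy.
have V'E : V' `<=` E.
  move=> x V'x.
  pose y := x - proj V x - (hdot x e / hdot e e) *: e.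
  have ee : hdot e e != 0 by apply/eqP => /dot_self0.
  have Vp := proj_in Vc x.
  have V'y : V' y.
    apply: (subspaceB V'c.1); last exact: subspaceZ V'c.1 V'e.
    by apply: (subspaceB V'c.1) => //; exact: VV'.
  have oy : orth V y.
    apply: (subspaceB (closed_orth V).1); first exact: proj_orth.
    exact: (subspaceZ _ (closed_orth V).1).
  have oye : orth [set e] y.
    move=> _ ->; rewrite /y !dotBl dotZl divfK//.
    have -> : hdot (proj V x) e = 0 by exact/dot_eq0C/oe.
    by rewrite subr0 subrr.
  have : y = 0 by apply: dot_self0; exact: V'y.
  move=> /eqP; rewrite subr_eq0 => /eqP xE; rewrite -(subrK (proj V x) x) xE.
  by apply: subspaceD => //; [exact: subspaceZ|exact: VE].
have V'cE : V' `<=` closure E by move=> x /V'E; exact: subset_closure.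
have Zc := closed_ominus V cEc; set Z := ominus (closure E) V in Zc fin *.
have Lc := closed_ominus V V'c; set L := ominus V' V in Lc *.
have LZ : L `<=` Z by move=> x [V'x ox]; split=> //; exact: V'cE.
have ZL : ominus Z L = ominus (closure E) V'.
  apply/seteqP; split=> x.
    move=> [[cx ox] oL]; split=> // y V'y.
    have xp : hdot x (proj V y) = 0 by apply: ox; exact: proj_in.
    rewrite -(subrK (proj V y) y) dotDr xp addr0.
    by apply: oL; exact: sub_proj_ominus.
  move=> [cx ox]; split; last by move=> y [V'y _]; exact: ox.
  by split=> // y /VV'; exact: ox.
have := hdim_ominus Lc Zc LZ; rewrite ZL card_eq_le => /andP[_ le].
have leV' := min _ V'c V'E.
have Ln0 : hdim L !=set0 by apply: (hdim_neq0 Lc (x := e)).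
apply: (finite_cardinal_add_lt _ Ln0 (card_le_trans le leV')).
apply: card_le_finite fin; apply: card_le_trans le.
exact: card_le_trans (le_cardinal_addl _ _) (cardinal_addC_le _ _).
Qed.

End index.

(** * Spectral subspaces *)

Section spectral.
Context {R : realType}.
Implicit Types (H K : hilbertType R).

Lemma rnorm_small0 H (x : H) (C : R) : 0 <= C ->
  (forall e : R, 0 < e -> nm x <= C * e) -> x = 0.
Proof.
move=> C0 h; apply/rnorm_eq0/eqP; rewrite eq_le rnorm_ge0 andbT.
apply/ler_addgt0Pr => e e0; rewrite add0r.
have C1 : 0 < C + 1 by rewrite ltr_wpDl.
apply: le_trans (h (e / (C + 1)) (divr_gt0 e0 C1)) _.
by rewrite mulrCA ler_piMr ?(ltW e0)// ler_pdivrMr// mul1r lerDl.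
Qed.

(** The limit is taken pointwise; it is linear and bounded because the
    convergence is uniform on balls. *)
Lemma op_complete H K (S : nat -> 'B(H, K)) :
  (forall e : R, 0 < e -> exists N, forall m n, (N <= m)%N -> (N <= n)%N ->
    forall x, nm (S m x - S n x) <= e * nm x) ->
  exists T : 'B(H, K), forall e : R, 0 < e -> exists N, forall n, (N <= n)%N ->
    forall x, nm (T x - S n x) <= e * nm x.
Proof.
move=> cS.
have /choice[f fP] x : exists y, seq_cvg (fun n => S n x) y.
  apply: seq_cauchy_cvg => e e0.
  have x1 : 0 < nm x + 1 by rewrite ltr_wpDl// rnorm_ge0.
  have [N hN] := cS _ (divr_gt0 e0 x1).
  exists N => m n Nm Nn; apply: le_lt_trans (hN _ _ Nm Nn x) _.
  by rewrite mulrAC ltr_pdivrMr// ltr_pM2l// ltrDl.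
have fS e : 0 < e -> exists N, forall n, (N <= n)%N ->
    forall x, nm (f x - S n x) <= e * nm x.
  move=> e0; have [N hN] := cS _ e0; exists N => n Nn x.
  apply/ler_addgt0Pr => e' e'0; have [N' hN'] := fP x _ e'0.
  have h1 := hN' _ (leq_maxl N' N).
  have h2 := hN _ _ (leq_maxr N' N) Nn x.
  apply: le_trans (rnorm_triangle (S (maxn N' N) x) _ _) _.
  by rewrite rnormB addrC lerD// ltW.
have [T hT] : exists T : 'B(H, K), forall x, T x = f x.
  apply: mk_op.
    move=> a x y; apply/eqP; rewrite -subr_eq0; apply/eqP.
    apply: (@rnorm_small0 _ _ (nm (a *: x + y) + nm (a *: x) + nm y)).
      by rewrite !addr_ge0// rnorm_ge0.
    move=> e /fS[N /(_ N (leqnn N)) hN].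
    have -> : f (a *: x + y) - (a *: f x + f y) =
        (f (a *: x + y) - S N (a *: x + y)) -
        (a *: (f x - S N x) + (f y - S N y)).
      rewrite opD opZ scalerBr; set u := f (_ + _); set v := a *: S N x.
      by rewrite addrACA -opprD opprB addrA subrK.
    apply: le_trans (rnormD _ _) _; rewrite rnormN.
    rewrite mulrDl mulrDl -addrA lerD//; first by rewrite mulrC; exact: hN.
    apply: le_trans (rnormD _ _) _; rewrite lerD//.
      by rewrite !rnormZ -mulrA ler_wpM2l ?[nm x * e]mulrC ?hN// -ler0c -cabsE normr_ge0.
    by rewrite mulrC; exact: hN.
  have [N /(_ N (leqnn N)) hN] := fS 1 ltr01.
  have [M M0 hM] := op_bound (S N).
  exists (1 + M) => x; rewrite -[f x](subrK (S N x)).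
  by apply: le_trans (rnormD _ _) _; rewrite mulrDl lerD.
exists T => e /fS[N hN]; exists N => n Nn x; rewrite hT; exact: hN.
Qed.

(** Square root iteration for [1 - S ^ 2]: the operators [Q k] defined by
    [Q k.+1 = (1 - S ^ 2 + (Q k) ^ 2) / 2] are dominated by the scalars [q k]
    obtained for [S = 0], which increase and stay below [1]. So are the
    differences of consecutive terms, and the sequence converges in norm. The
    limit [Q] satisfies [(1 - Q) ^ 2 = S ^ 2]: it makes [1 - Q] the absolute
    value of [S]. *)
Lemma modulus_iteration H (S : 'B(H, H)) :
  (forall x y, hdot (S x) y = hdot x (S y)) ->
  (forall x, nm (S x) <= nm x) ->
  exists Q : 'B(H, H), [/\
    forall x y, hdot (Q x) y = hdot x (Q y),
    forall x, nm (Q x) <= nm x,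
    forall (A : 'B(H, H)), (forall x, A (S x) = S (A x)) ->
      forall x, A (Q x) = Q (A x) &
    forall x, 2%:R%:C *: Q x = x - S (S x) + Q (Q x)].
Proof.
move=> Ssym S1.
have Z1 x : nm (x - S (S x)) <= nm x.
  apply: sqr_le; first exact: rnorm_ge0.
  rewrite rnormB2 Re_dotC Ssym -rnorm_sqr_dot.
  have : nm (S (S x)) ^+ 2 <= nm (S x) ^+ 2.
    by rewrite ler_pXn2r ?nnegrE ?rnorm_ge0.
  have := sqr_ge0 (nm (S x)).
  by move: (nm (S (S x)) ^+ 2) (nm (S x) ^+ 2) (nm x ^+ 2) => *; lra.
have ex (T : 'B(H, H)) : exists T' : 'B(H, H), forall x,
    T' x = (2^-1)%:C *: (x - S (S x) + T (T x)).
  apply: mk_op.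
    move=> a x y; rewrite !opD !opZ -[RHS]/(_ + _).
    rewrite scalerA [a * _]mulrC -scalerA -scalerDr; congr (_ *: _).
    rewrite !scalerDr scalerN opprD.
    by rewrite [a *: x + y + _]addrACA [LHS]addrACA.
  have [M M0 hM] := op_bound T.
  exists (2^-1 * (1 + M * M)) => x.
  rewrite rnormZr ger0_norm// -mulrA ler_pM2l//.
  apply: le_trans (rnormD _ _) _; rewrite mulrDl mul1r lerD//.
  by apply: le_trans (hM _) _; rewrite -mulrA ler_wpM2l.
have /choice[g gP] := ex.
pose Q n : 'B(H, H) := iter n g (\0 : 'B(H, H)).
pose q n : R := iter n (fun t => 2^-1 * (1 + t ^+ 2)) 0.
have QS n x : Q n.+1 x = (2^-1)%:C *: (x - S (S x) + Q n (Q n x)) by exact: gP.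
have qS n : q n.+1 = 2^-1 * (1 + q n ^+ 2) by [].
have q01 n : 0 <= q n <= 1.
  elim: n => [|n /andP[IH0 IH1]]; first by rewrite lexx ler01.
  have : q n ^+ 2 <= 1 by rewrite expr_le1.
  have := sqr_ge0 (q n); rewrite qS; move: (q n ^+ 2) => t t0 t1.
  by apply/andP; split; lra.
have qS_ge n : q n <= q n.+1.
  rewrite qS -subr_ge0.
  have -> : 2^-1 * (1 + q n ^+ 2) - q n = 2^-1 * (1 - q n) ^+ 2 by field.
  by rewrite mulr_ge0// sqr_ge0.
have qle m n : (m <= n)%N -> q m <= q n.
  move=> /subnKC <-; elim: (n - m)%N => [|k IH]; first by rewrite addn0.
  by apply: le_trans IH _; rewrite addnS.
have Qq n x : nm (Q n x) <= q n * nm x.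
  have nrm0 : nm (0 : H) = 0 by exact: rnorm0.
  elim: n x => [|n IH] x; first by rewrite /= nrm0 mul0r.
  rewrite QS qS rnormZr ger0_norm// -mulrA ler_pM2l//.
  apply: le_trans (rnormD _ _) _; rewrite mulrDl mul1r lerD//.
  apply: le_trans (IH _) _; rewrite expr2 -mulrA ler_wpM2l//.
  by have /andP[] := q01 n.
have Qstep n x : nm (Q n.+1 x - Q n x) <= (q n.+1 - q n) * nm x.
  elim: n x => [|n IH] x; first by rewrite subr0 /q [in X in X * _]subr0; exact: (Qq 1%N).
  have -> : Q n.+2 x - Q n.+1 x = (2^-1)%:C *:
      (Q n.+1 (Q n.+1 x - Q n x) + (Q n.+1 (Q n x) - Q n (Q n x))).
    rewrite (QS n.+1) [X in _ - X]QS -scalerBr opprD addrACA subrr add0r.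
    by rewrite (opB (Q n.+1)) addrA subrK.
  rewrite rnormZr ger0_norm//.
  have -> : (q n.+2 - q n.+1) * nm x = 2^-1 *
     (q n.+1 * ((q n.+1 - q n) * nm x) + (q n.+1 - q n) * (q n * nm x)).
    by rewrite (qS n.+1) {2}(qS n) ; field.
  rewrite ler_pM2l//; apply: le_trans (rnormD _ _) _; apply: lerD.
    apply: le_trans (Qq _ _) _; rewrite ler_wpM2l//.
    by have /andP[] := q01 n.+1.
  by apply: le_trans (IH _) _; rewrite ler_wpM2l ?subr_ge0.
have Qdiff m n x : (n <= m)%N -> nm (Q m x - Q n x) <= (q m - q n) * nm x.
  move=> /subnKC <-; elim: (m - n)%N => [|k IH].
    by rewrite addn0 !subrr rnorm0 mul0r.
  apply: le_trans (rnorm_triangle (Q (n + k)%N x) _ _) _.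
  have -> : (q (n + k.+1)%N - q n) * nm x =
      (q (n + k).+1 - q (n + k)%N) * nm x + (q (n + k)%N - q n) * nm x.
    by rewrite addnS; ring.
  by rewrite addnS lerD.
have [Q0 Q0P] : exists T : 'B(H, H), forall e : R, 0 < e -> exists N, forall n,
    (N <= n)%N -> forall x, nm (T x - Q n x) <= e * nm x.
  apply: op_complete => e e0.
  have hs : has_sup (range q).
    split; first by exists (q 0%N); exists 0%N.
    by exists 1 => _ [n _ <-]; have /andP[] := q01 n.
  have [_ [N _ <-] hN] := sup_adherent e0 hs.
  have qd m n : (N <= m)%N -> (N <= n)%N -> q m - q n <= e.
    move=> /qle hm /qle hn.
    have : q m <= sup (range q) by apply: ub_le_sup; [exact: hs.2|exists m].
    by lra.
  exists N => m n Nm Nn x; have [nlem|/ltnW mlen] := leqP n m.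
    by apply: le_trans (Qdiff _ _ _ nlem) _; rewrite ler_wpM2r ?rnorm_ge0// qd.
  rewrite rnormB; apply: le_trans (Qdiff _ _ _ mlen) _.
  by rewrite ler_wpM2r ?rnorm_ge0// qd.
have Q0e e : 0 < e -> exists n, (forall x, nm (Q0 x - Q n x) <= e * nm x) /\
    (forall x, nm (Q0 x - Q n.+1 x) <= e * nm x).
  by move=> /Q0P[N hN]; exists N; split; apply: hN.
have Q01 x : nm (Q0 x) <= nm x.
  apply/ler_addgt0Pr => e e0.
  have x1 : 0 < nm x + 1 by rewrite ltr_wpDl// rnorm_ge0.
  have [n [hn _]] := Q0e _ (divr_gt0 e0 x1).
  rewrite -[Q0 x](subrK (Q n x)); apply: le_trans (rnormD _ _) _.
  rewrite addrC lerD//.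
    apply: le_trans (Qq _ _) _; rewrite ler_piMl ?rnorm_ge0//.
    by have /andP[] := q01 n.
  apply: le_trans (hn _) _; rewrite mulrAC ler_pdivrMr// ler_pM2l//.
  by rewrite lerDl.
exists Q0; split => //.
- have Qsym n x y : hdot (Q n x) y = hdot x (Q n y).
    elim: n x y => [|n IH] x y; first by rewrite dot0l dot0r.
    rewrite !QS dotZl dotZr conjCE conjc_real; congr (_ * _).
    by rewrite dotDl dotBl dotDr dotBr !Ssym !IH.
  move=> x y; apply/eqP; rewrite -subr_eq0; apply/eqP/cabs_eq0.
  apply/ler_addgt0Pr => e e0; rewrite add0r.
  set c := nm x * nm y + 1.
  have c0 : 0 < c by rewrite ltr_wpDl// mulr_ge0 ?rnorm_ge0.
  have [n [hn _]] := Q0e (e / 2 / c) (divr_gt0 (divr_gt0 e0 (ltr0Sn _ 1)) c0).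
  have -> : hdot (Q0 x) y - hdot x (Q0 y) =
      hdot (Q0 x - Q n x) y - hdot x (Q0 y - Q n y).
    by rewrite dotBl dotBr Qsym opprB addrA subrK.
  have h1 := cauchy_schwarz (Q0 x - Q n x) y.
  have h2 := cauchy_schwarz x (Q0 y - Q n y).
  have h3 : cabs (hdot (Q0 x - Q n x) y - hdot x (Q0 y - Q n y)) <=
      cabs (hdot (Q0 x - Q n x) y) + cabs (hdot x (Q0 y - Q n y)).
    by have := ler_normB (hdot (Q0 x - Q n x) y) (hdot x (Q0 y - Q n y));
      rewrite !cabsE -rmorphD lecR.
  apply: (le_trans h3).
  have bnd t : t <= (e / 2 / c) * (nm x * nm y) -> t <= e / 2.
    move=> /le_trans; apply; rewrite mulrAC ler_pdivrMr// ler_pM2l ?divr_gt0//.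
    by rewrite lerDl.
  rewrite (splitr e) lerD//; apply: bnd.
    by apply: (le_trans h1); rewrite mulrA ler_wpM2r ?rnorm_ge0.
  by apply: (le_trans h2); rewrite mulrCA ler_wpM2l ?rnorm_ge0.
- move=> A AS x.
  have AQ n y : A (Q n y) = Q n (A y).
    elim: n y => [|n IH] y; first by rewrite /= op0.
    by rewrite !QS opZ opD opB !AS !IH.
  apply/eqP; rewrite -subr_eq0; apply/eqP.
  have [M M0 hM] := op_bound A.
  apply: (@rnorm_small0 _ _ (M * nm x + nm (A x))).
    by rewrite addr_ge0// ?mulr_ge0 ?rnorm_ge0.
  move=> e /Q0e[n [hn _]].
  have -> : A (Q0 x) - Q0 (A x) = A (Q0 x - Q n x) - (Q0 (A x) - Q n (A x)).
    by rewrite opB AQ opprB addrA subrK.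
  apply: le_trans (rnormD _ _) _; rewrite rnormN mulrDl lerD//; last by rewrite mulrC.
  by apply: le_trans (hM _) _; rewrite -mulrA ler_wpM2l// mulrC.
- move=> x; apply/eqP; rewrite -subr_eq0; apply/eqP.
  apply: (@rnorm_small0 _ _ (4 * nm x)); first by rewrite mulr_ge0 ?rnorm_ge0.
  move=> e e0; have [n [hn hn1]] := Q0e _ e0.
  have Q2 : 2%:R%:C *: Q n.+1 x = x - S (S x) + Q n (Q n x).
    by rewrite QS scalerA -rmorphM divff// scale1r.
  have -> : 2%:R%:C *: Q0 x - (x - S (S x) + Q0 (Q0 x)) =
      2%:R%:C *: (Q0 x - Q n.+1 x) -
      ((Q0 (Q0 x) - Q n (Q0 x)) + Q n (Q0 x - Q n x)).
    have -> : Q0 (Q0 x) - Q n (Q0 x) + Q n (Q0 x - Q n x) =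
        Q0 (Q0 x) - Q n (Q n x) by rewrite (opB (Q n)) addrA subrK.
    rewrite scalerBr Q2.
    rewrite -[RHS]addrA -opprD; congr (_ - _).
    by rewrite -[RHS]addrA [X in _ = _ + X]addrC subrK.
  apply: le_trans (rnormD _ _) _; rewrite rnormN rnormZr ger0_norm//.
  have h1 := hn1 x; have h2 := hn (Q0 x).
  have h3 : nm (Q n (Q0 x - Q n x)) <= e * nm x.
    apply: le_trans (Qq _ _) _; apply: le_trans (hn x).
    by rewrite ler_piMl ?rnorm_ge0//; have /andP[] := q01 n.
  have h4 := rnormD (Q0 (Q0 x) - Q n (Q0 x)) (Q n (Q0 x - Q n x)).
  have h5 : nm (Q0 (Q0 x) - Q n (Q0 x)) <= e * nm x.
    by apply: (le_trans h2); rewrite ler_wpM2l// ltW.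
  rewrite -[4 * nm x * e]mulrA [nm x * e]mulrC.
  by move: h1 h3 h4 h5; move: (e * nm x) => *; lra.
Qed.

End spectral.

Section cut.
Context {R : realType}.
Implicit Types (H K : hilbertType R).

(** With [S] a positive multiple of [T - d] and [Y] its absolute value, the
    kernel of [Y - S] is where [S >= 0]; on its complement [Y + S] vanishes,
    since [(Y - S) (Y + S) = 0], so that there [S <= 0]. *)
Lemma spectral_cut H (T : 'B(H, H)) (d : R) :
  (forall x y, hdot (T x) y = hdot x (T y)) ->
  exists W : set H, [/\ closed_subspace W, forall x, W x -> W (T x),
    forall x, W x -> d * nm x ^+ 2 <= complex.Re (hdot (T x) x) &
    forall x, orth W x -> complex.Re (hdot (T x) x) <= d * nm x ^+ 2].
Proof.
move=> Tsym.
have [M0 M00 hM0] := op_bound T.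
pose s : R := (M0 + `|d| + 1)^-1.
have s0 : 0 < s by rewrite invr_gt0 ltr_wpDl// addr_ge0.
have [S hS] : exists S : 'B(H, H), forall x, S x = s%:C *: (T x - d%:C *: x).
  apply: mk_op.
    move=> a x y; rewrite opD opZ scalerA [a * _]mulrC -scalerA -scalerDr.
    congr (_ *: _); rewrite scalerDr opprD !scalerBr !scalerA [d%:C * a]mulrC.
    exact: addrACA.
  exists (s * (M0 + `|d|)) => x.
  rewrite rnormZr (gtr0_norm s0) -mulrA ler_pM2l//.
  by apply: le_trans (rnormD _ _) _; rewrite rnormN rnormZr mulrDl lerD.
have S1 x : nm (S x) <= nm x.
  rewrite hS rnormZr (gtr0_norm s0) ler_pdivrMl ?invr_gt0//; last first.
    by rewrite ltr_wpDl// addr_ge0.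
  apply: le_trans (rnormD _ _) _; rewrite rnormN rnormZr.
  by rewrite !mulrDl mul1r -addrA lerD// lerDl rnorm_ge0.
have Ssym x y : hdot (S x) y = hdot x (S y).
  rewrite !hS dotZl dotZr conjCE conjc_real; congr (_ * _).
  by rewrite dotBl dotBr Tsym dotZl dotZr conjCE conjc_real.
have [Q [Qsym Q1 Qcomm Q2]] := modulus_iteration Ssym S1.
have QS x : S (Q x) = Q (S x) by apply: Qcomm.
have TS x : T (S x) = S (T x) by rewrite !hS opZ opB opZ.
have TQ x : T (Q x) = Q (T x) by apply: Qcomm.
(* [1 - Q] is the operator Y *)
have Y2 x : (x - Q x) - Q (x - Q x) = S (S x).
  have := Q2 x; rewrite opB rmorph_nat scaler_nat mulr2n => h.
  have -> : x - Q x - (Q x - Q (Q x)) = x - (Q x + Q x) + Q (Q x).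
    by rewrite opprB addrA addrAC opprD addrA.
  rewrite h; set a := S (S x); set b := Q (Q x).
  by rewrite opprD opprB addrA subrK addrC subrK.
have Y0 x : 0 <= complex.Re (hdot (x - Q x) x).
  rewrite dotBl ReD ReN -rnorm_sqr_dot subr_ge0.
  apply: le_trans (Re_dot_le _ _) _; rewrite expr2.
  by rewrite ler_wpM2r ?rnorm_ge0.
have [D hD] : exists D : 'B(H, H), forall x, D x = x - Q x - S x.
  apply: mk_op.
    move=> a x y; rewrite !opD !opZ !scalerBr.
    by rewrite !opprD [a *: x + y + _]addrACA [LHS]addrACA.
  exists 3 => x; apply: le_trans (rnormD _ _) _; rewrite rnormN.
  have := rnormD x (- Q x); rewrite rnormN.
  by have := Q1 x; have := S1 x; lra.
pose s' : R := s^-1.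
have Re_T x : complex.Re (hdot (T x) x) =
    s' * complex.Re (hdot (S x) x) + d * nm x ^+ 2.
  rewrite hS dotZl dotBl dotZl ReZ mulrA mulVf ?gt_eqF// mul1r.
  by rewrite ReD ReN ReZ -rnorm_sqr_dot subrK.
have s'0 : 0 < s' by rewrite invr_gt0.
exists (ker D); split.
- exact: closed_ker.
- move=> x /eqP; rewrite hD subr_eq0 => /eqP Dx.
  by rewrite /ker /= hD -TQ -TS -opB Dx subrr.
- move=> x /eqP; rewrite hD subr_eq0 => /eqP Dx.
  by rewrite Re_T lerDr -Dx mulr_ge0// ltW.
- move=> x ox; rewrite Re_T -lerBrDr subrr pmulr_rle0//.
  have YS y : ker D (y - Q y + S y).
    have -> : ker D = [set x | D x = 0] by [].
    rewrite /= hD (opD Q) (opD S) -(Y2 y).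
    have -> : S (y - Q y) = S y - Q (S y) by rewrite opB QS.
    set a := y - Q y; set b := S y.
    have -> : b - Q b + (a - Q a) = a + b - (Q a + Q b).
      by rewrite addrACA -opprD (addrC b) (addrC (Q b)).
    exact: subrr.
  have Sx : x - Q x + S x = 0.
    apply: dot_inj => y; rewrite dot0r dotDr dotBr -Qsym -Ssym -dotBl -dotDl.
    by apply: dot_eq0C; apply: ox; exact: YS.
  have -> : S x = - (x - Q x) by apply/eqP; rewrite -addr_eq0 addrC Sx.
  by rewrite dotNl ReN oppr_le0.
Qed.

(** The image of [W] is closed, and a vector [q] of [W] orthogonal to it satisfies
    [hdot (T q) q = 0]. *)
Lemma sub_range_cut H (T : 'B(H, H)) (W : set H) (d : R) : 0 < d ->
  (forall x y, hdot (T x) y = hdot x (T y)) -> closed_subspace W ->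
  (forall x, W x -> W (T x)) ->
  (forall x, W x -> d * nm x ^+ 2 <= complex.Re (hdot (T x) x)) ->
  W `<=` T @` W.
Proof.
move=> d0 Tsym Wc TW Td.
have Tbb : bounded_below T W d.
  split=> // x Wx; have [->|/eqP x0] := eqVneq x 0.
    by rewrite op0 !rnorm0 mulr0.
  rewrite -(ler_pM2r (rnorm_gt0 x0)) -mulrA -expr2.
  exact: le_trans (Td _ Wx) (Re_dot_le _ _).
have TWc := closed_image Wc Tbb.
move=> w Ww; set p := proj (T @` W) w.
have TWp : (T @` W) p by exact: proj_in.
have Wq : W (w - p).
  by apply: (subspaceB Wc.1) => //; case: TWp => x Wx <-; exact: TW.
have : hdot (T (w - p)) (w - p) = 0.
  by apply: dot_eq0C; apply: (proj_orth TWc); exists (w - p).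
move=> h; have := Td _ Wq; rewrite h pmulr_rle0// => q0.
have : w - p = 0.
  apply/rnorm_eq0/eqP; rewrite -sqrf_eq0; apply/eqP/le_anti.
  by rewrite q0 sqr_ge0.
by move=> /eqP; rewrite subr_eq0 => /eqP ->.
Qed.

(** The spectral subspace of [T (adjoint T)] above the threshold [d]. *)
Lemma range_cut H K (T : 'B(H, K)) (d : R) : 0 < d ->
  exists W : set K, [/\ closed_subspace W, W `<=` range T,
    exists c, bounded_below (adjoint T) W c &
    forall y, orth W y -> nm (adjoint T y) ^+ 2 <= d * nm y ^+ 2].
Proof.
move=> d0; pose P : 'B(K, K) := T \o adjoint T.
have PE y : complex.Re (hdot (P y) y) = nm (adjoint T y) ^+ 2.
  by rewrite /P /= adjointE rnorm_sqr_dot.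
have Psym x y : hdot (P x) y = hdot x (P y).
  by rewrite /P /= adjointE (adjointE' T).
have [W [Wc PW Wd Wd']] := spectral_cut d Psym.
exists W; split=> //.
- move=> w /(sub_range_cut d0 Psym Wc PW Wd)[x _ <-].
  by exists (adjoint T x).
- exists (Num.sqrt d); split; first by rewrite sqrtr_gt0.
  move=> x Wx; apply: sqr_le; first exact: rnorm_ge0.
  by rewrite exprMn sqr_sqrtr ?(ltW d0)// -PE; exact: Wd.
- by move=> y oy; rewrite -PE; exact: Wd'.
Qed.

End cut.

(** * Inverses on subspaces and isometries *)

Section partial_inverse.
Context {R : realType}.
Implicit Types (H K : hilbertType R).

Lemma bounded_below_inverse H K (T : 'B(H, K)) (V : set H) (W : set K) c :
  closed_subspace V -> closed_subspace W ->
  bounded_below T V c -> T @` V = W ->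
  exists L : 'B(K, H), [/\ forall y, V (L y), forall y, T (L y) = proj W y &
    forall x, V x -> L (T x) = x].
Proof.
move=> Vc Wc Tbb TV.
have /choice[f fP] y : exists x, V x /\ T x = proj W y.
  have : W (proj W y) by exact: proj_in.
  by rewrite -TV => -[x Vx Tx]; exists x.
have inj x x' : V x -> V x' -> T x = T x' -> x = x'.
  move=> Vx Vx' Tx; apply/eqP; rewrite -subr_eq0; apply/eqP.
  apply: (bounded_below_inj Tbb); first exact: subspaceB Vc.1 Vx Vx'.
  by rewrite opB Tx subrr.
have [c0 cT] := Tbb.
have [L hL] : exists L : 'B(K, H), forall y, L y = f y.
  apply: mk_op.
    move=> a x y; have [Vx Tx] := fP x; have [Vy Ty] := fP y.
    apply: inj; first by have [] := fP (a *: x + y).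
      by apply: subspaceD => //; [exact: Vc.1|apply: subspaceZ => //; exact: Vc.1].
    have [_ ->] := fP (a *: x + y).
    by rewrite !opD !opZ Tx Ty.
  exists c^-1 => y; have [Vy Ty] := fP y.
  rewrite ler_pdivlMl//; apply: le_trans (cT _ Vy) _.
  by rewrite Ty; exact: proj_le.
exists L; split.
- by move=> y; rewrite hL; have [] := fP y.
- by move=> y; rewrite hL; have [] := fP y.
- move=> x Vx; rewrite hL; have [Vy Ty] := fP (T x).
  by apply: inj => //; rewrite Ty proj_id// -TV; exists x.
Qed.

(** The linear extension of [phi], as a relation: it is isometric when [phi]
    maps an orthonormal set injectively to an orthonormal set, so that its
    closure is still a function. *)
Inductive lin_ext H K (E : set H) (phi : H -> K) : H -> K -> Prop :=
| lin_ext_gen e : E e -> lin_ext E phi e (phi e)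
| lin_ext0 : lin_ext E phi 0 0
| lin_extD (a : R[i]) x y x' y' : lin_ext E phi x y -> lin_ext E phi x' y' ->
    lin_ext E phi (a *: x + x') (a *: y + y').

(** The isometry is the closure of the linear extension of a bijection between
    two orthonormal bases. *)
Lemma hdim_isometry H K (V : set H) (W : set K) :
  closed_subspace V -> closed_subspace W -> hdim V #= hdim W ->
  exists U : 'B(H, K), [/\ forall x, W (U x), forall x, V x -> nm (U x) = nm x,
    forall x, orth V x -> U x = 0 & U @` V = W].
Proof.
move=> Vc Wc VW.
have Eb := hdimP Vc; have Fb := hdimP Wc.
set E := hdim V in VW Eb; set F := hdim W in VW Fb.
have [phi [phiF phiI phiS]] : exists phi : H -> K, [/\ forall e, E e -> F (phi e),
    forall e e', E e -> E e' -> phi e = phi e' -> e = e' &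
    forall f, F f -> exists2 e, E e & phi e = f].
  have /card_set_bijP[phi [h1 h2 h3]] := VW.
  exists phi; split; first exact: h1.
    by move=> e e' Ee Ee'; apply: h2; rewrite inE.
  by move=> f /h3[e Ee <-]; exists e.
have [[E1 Eo] _] := Eb; have [[F1 Fo] _] := Fb.
pose G := lin_ext E phi.
have Giso x y x' y' : G x y -> G x' y' -> hdot x x' = hdot y y'.
  move=> Gxy; move: x' y'.
  have lin : forall u v, (forall e, E e -> hdot u e = hdot v (phi e)) ->
      forall x' y', G x' y' -> hdot u x' = hdot v y'.
    move=> u v uv x' y'; elim => //; first by rewrite !dot0r.
    by move=> a p q p' q' _ IH _ IH'; rewrite !dotDr !dotZr IH IH'.
  apply: lin => e Ee; elim: Gxy => [e' Ee'| |a p q p' q' _ IH _ IH'].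
  - have [->|/eqP ne] := eqVneq e' e.
      by rewrite -!hdot_norm E1// F1//; exact: phiF.
    rewrite Eo// Fo//; [exact: phiF|exact: phiF|].
    by move=> /phiI; move=> /(_ Ee' Ee).
  - by rewrite !dot0l.
  - by rewrite !dotDl !dotZl IH IH'.
have Gnorm x y : G x y -> nm x = nm y.
  move=> Gxy; apply: (@pexpIrn _ 2) => //; rewrite ?nnegrE ?rnorm_ge0//.
  by rewrite !rnorm_sqr_dot (Giso _ _ _ _ Gxy Gxy).
have Gsub x y x' y' : G x y -> G x' y' -> G (x - x') (y - y').
  move=> h h'; rewrite [x - x']addrC [y - y']addrC -[- x']scaleN1r -[- y']scaleN1r.
  exact: lin_extD.
have Gdom x : linear_span E x -> exists2 y, G x y & W y.
  move: x; apply: linear_span_min.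
    split; first by exists 0; [exact: lin_ext0|exact: Wc.1.1].
    move=> a x x' [y Gy Wy] [y' Gy' Wy']; exists (a *: y + y').
      exact: lin_extD.
    exact: Wc.1.2.
  move=> e Ee; exists (phi e); first exact: lin_ext_gen.
  by apply: (onb_sub Fb); exact: phiF.
pose L x y := forall e : R, 0 < e -> exists x' y',
  [/\ G x' y', nm (x - x') < e & nm (y - y') < e].
have Llin a x y x' y' : L x y -> L x' y' -> L (a *: x + x') (a *: y + y').
  move=> Lxy Lxy' e e0.
  have a1 : 0 < cabs a + 1 by rewrite ltr_wpDl// -ler0c -cabsE normr_ge0.
  have e1 : 0 < e / 2 / (cabs a + 1) by rewrite !divr_gt0.
  have [p [q [Gpq xp yq]]] := Lxy _ e1.
  have [|p' [q' [Gpq' xp' yq']]] := Lxy' (e / 2); first by rewrite divr_gt0.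
  have bnd (M : hilbertType R) (u v u' v' : M) : nm (u - v) < e / 2 / (cabs a + 1) ->
      nm (u' - v') < e / 2 -> nm (a *: u + u' - (a *: v + v')) < e.
    move=> h h'; rewrite opprD addrACA -scalerBr.
    apply: le_lt_trans (rnormD _ _) _; rewrite (splitr e) ler_ltD// rnormZ.
    move: h; rewrite ltr_pdivlMr// mulrC => /ltW; apply: le_trans.
    by rewrite ler_wpM2r ?rnorm_ge0// lerDl.
  exists (a *: p + p'), (a *: q + q'); split; [exact: lin_extD|exact: bnd|exact: bnd].
have Lnorm x y : L x y -> nm x = nm y.
  move=> Lxy; apply/eqP; rewrite eq_le; apply/andP; split;
    apply/ler_addgt0Pr => e e0;
    have [|p [q [/Gnorm Gpq xp yq]]] := Lxy (e / 2); rewrite ?divr_gt0//.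
    have := rnormD (x - p) p; rewrite subrK.
    have := rnormD (q - y) y; rewrite subrK (rnormB q).
    by lra.
  have := rnormD (y - q) q; rewrite subrK.
  have := rnormD (p - x) x; rewrite subrK (rnormB p).
  by lra.
have Lfun x y y' : L x y -> L x y' -> y = y'.
  move=> h h'; apply/eqP; rewrite -subr_eq0; apply/eqP/rnorm_eq0.
  have := Llin (-1) _ _ _ _ h' h; rewrite !scaleN1r addNr => /Lnorm.
  by rewrite rnorm0 addrC.
have Ldom x : V x -> exists y, W y /\ L x y.
  move=> Vx; have : closure (linear_span E) x by have [_ ->] := Eb.
  move=> /closure_seq[u uE ux].
  have /choice[z zP] n : exists z, G (u n) z /\ W z.
    by have [z ? ?] := Gdom _ (uE n); exists z.
  have zc : seq_cauchy z.
    move=> e /(seq_cvg_cauchy ux)[N hN]; exists N => m n Nm Nn.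
    have [Gm _] := zP m; have [Gn _] := zP n.
    by rewrite -(Gnorm _ _ (Gsub _ _ _ _ Gm Gn)); exact: hN.
  have [y zy] := seq_cauchy_cvg zc; exists y; split.
    by apply/Wc.2/(seq_cvg_closure _ zy) => n; have [] := zP n.
  move=> e e0; have [N1 h1] := ux _ e0; have [N2 h2] := zy _ e0.
  exists (u (maxn N1 N2)), (z (maxn N1 N2)); split.
  - by have [] := zP (maxn N1 N2).
  - by rewrite rnormB; apply: h1; exact: leq_maxl.
  - by rewrite rnormB; apply: h2; exact: leq_maxr.
have /choice[f fP] x : exists y, W y /\ L (proj V x) y.
  by apply: Ldom; exact: proj_in.
have [U hU] : exists U : 'B(H, K), forall x, U x = f x.
  apply: mk_op.
    move=> a x y; have [_ Lx] := fP x; have [_ Ly] := fP y.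
    have [_ h] := fP (a *: x + y); apply: Lfun h _.
    by rewrite opD opZ; exact: Llin.
  exists 1 => x; have [_ /Lnorm <-] := fP x.
  by rewrite mul1r; exact: proj_le.
have Uiso x : V x -> nm (U x) = nm x.
  by move=> Vx; rewrite hU; have [_ /Lnorm <-] := fP x; rewrite proj_id.
have UW x : W (U x) by rewrite hU; have [] := fP x.
have Uc : closed_subspace (U @` V).
  apply: (closed_image (c := 1)) => //; split=> // x Vx.
  by rewrite mul1r Uiso.
exists U; split=> //.
- move=> x ox; rewrite hU; have [_ /Lnorm h] := fP x.
  by apply: rnorm_eq0; rewrite -h proj_orth0// rnorm0.
- apply/seteqP; split; first by move=> _ [x _ <-].
  have [_ <-] := Fb; move=> y cy; apply: Uc.2; move: y cy; apply: closureS.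
  apply: linear_span_min; first exact: Uc.1.
  move=> y /phiS[e Ee <-]; exists e; first exact: (onb_sub Eb).
  rewrite hU; have [_ h] := fP e; apply: Lfun h _ => r r0.
  exists e, (phi e); rewrite (proj_id Vc (onb_sub Eb Ee)).
  by rewrite !subrr !rnorm0; split=> //; exact: lin_ext_gen.
Qed.

End partial_inverse.

(** * The index as a least codimension *)

Section least_codimension.
Context {R : realType}.
Implicit Types (H K : hilbertType R).

Lemma card_eqW {T U} {A : set T} {B : set U} : A #= B -> A #<= B.
Proof. by rewrite card_eq_le => /andP[]. Qed.

Lemma card_eqWr {T U} {A : set T} {B : set U} : A #= B -> B #<= A.
Proof. by rewrite card_eq_le => /andP[]. Qed.

Lemma IC_le_codim H K (T : 'B(H, K)) (X V : set H) c :
  closed_subspace X -> closed_subspace V -> V `<=` X -> bounded_below T V c ->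
  IC (T @` X) #<= hdim (ominus (closure (T @` X)) (T @` V)).
Proof.
move=> Xc Vc VX Tbb.
have [V0 [_ _ _ min]] := ICP (subspace_image T Xc.1).
apply: min; first exact: closed_image Tbb.
exact: image_subset.
Qed.

(** By this lemma and the next one, the initial index is the least codimension
    of a closed subspace on which the operator is bounded below. *)
Lemma iota_le_codim H K (T : 'B(H, K)) (X V : set H) c :
  closed_subspace X -> closed_subspace V -> V `<=` X -> bounded_below T V c ->
  iota_i_on X T #<= hdim (ominus X V).
Proof.
move=> Xc Vc VX Tbb.
apply: card_le_trans (card_eqWr (codim_image Xc Vc VX Tbb)).
by apply: le_cardinal_add (card_lexx _) (IC_le_codim Xc Vc VX Tbb).
Qed.

Lemma iota_attained H K (T : 'B(H, K)) (X : set H) : closed_subspace X ->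
  exists V c, [/\ closed_subspace V, V `<=` X, bounded_below T V c &
    iota_i_on X T #= hdim (ominus X V)].
Proof.
move=> Xc; have [V0 [V0c V0T ICE _]] := ICP (subspace_image T Xc.1).
pose S : 'B(H, K) := T \o proj X.
have [|V [c [Vc Vker Sbb SV]]] := @bounded_below_section _ _ _ S V0 V0c.
  by move=> y /V0T[x Xx <-]; exists x => //; rewrite /S /= proj_id.
have VX : V `<=` X.
  move=> x /Vker ox; rewrite -(orth_orth Xc) => y oy; apply: ox.
  by rewrite /ker /S /= proj_orth0// op0.
have ST x : V x -> S x = T x by move=> /VX Xx; rewrite /S /= proj_id.
have Tbb : bounded_below T V c.
  by split=> [|x Vx]; [exact: Sbb.1|rewrite -ST//; exact: Sbb.2].
have TV : T @` V = V0.
  by rewrite -SV; apply/seteqP; split=> _ [x Vx <-]; exists x => //; rewrite ST.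
exists V, c; split=> //.
have := codim_image Xc Vc VX Tbb; rewrite card_eq_sym TV.
by apply: card_eq_trans; rewrite /iota_i_on ICE.
Qed.

End least_codimension.

Section index_arithmetic.
Context {T1 T2 T3 T4 T5 T6 T7 T8 T9 : Type}.

Lemma index_ge (v : set T1) (n : set T2) (a : set T3) (i : set T4) (k : set T5) :
  v #= cardinal_add n a -> absorbing i -> i #<= a -> k #<= a ->
  cardinal_add (cardinal_add n i) k #<= v.
Proof.
move=> vna iabs ia ka.
apply: card_le_trans (card_eqWr vna).
have le1 := le_cardinal_add (card_lexx (cardinal_add n i)) ka.
apply: card_le_trans le1 _.
apply: card_le_trans (card_eqWr (cardinal_addA n i a)) _.
exact: le_cardinal_add (card_lexx n) (card_eqW (cardinal_add_absorb iabs ia)).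
Qed.

(** Adding [iB], [iA] and [i'] to [N], to [a] and to [q] changes nothing, so
    that both [N] and [M] are equal to the sum of [q] and of either side of the
    index formula. *)
Lemma index_cancel (M : set T1) (N : set T2) (nA : set T3) (iA : set T4)
    (d : set T5) (i' : set T6) (nB : set T7) (iB : set T8)
    (U1 U2 U3 : Type) (a : set U1) (q : set U2) (q' : set U3) :
  M #= cardinal_add nA a -> absorbing iA -> iA #<= a ->
  a #= cardinal_add d q -> absorbing i' -> i' #<= q ->
  N #= cardinal_add nB q -> N #= cardinal_add nB q' -> absorbing iB ->
  iB #<= q' ->
  cardinal_add nB iB #= cardinal_add (cardinal_add nA iA) (cardinal_add d i') ->
  N #= M.
Proof.
move=> Ma iAabs iAa adq i'abs i'q Nq Nq' iBabs iBq' ind.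
apply: (card_eq_trans (B := cardinal_add (cardinal_add nB iB) q)).
  (* pass through [iB + N]: it absorbs [iB] when [N] is written with [q'] *)
  apply: (card_eq_trans (B := cardinal_add iB N)).
    apply: (card_eq_trans Nq'); apply: card_esym.
    apply: (card_eq_trans (eq_cardinal_add (card_eqxx iB) Nq')).
    apply: (card_eq_trans (cardinal_addA _ _ _)).
    apply: (card_eq_trans (eq_cardinal_add (cardinal_addC _ _) (card_eqxx _))).
    apply: (card_eq_trans (card_esym (cardinal_addA _ _ _))).
    exact: eq_cardinal_add (card_eqxx _) (cardinal_add_absorb iBabs iBq').
  apply: (card_eq_trans (eq_cardinal_add (card_eqxx iB) Nq)).
  apply: (card_eq_trans (cardinal_addA _ _ _)).
  exact: eq_cardinal_add (cardinal_addC _ _) (card_eqxx _).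
apply: card_esym; apply: (card_eq_trans Ma).
apply: (card_eq_trans (B := cardinal_add nA (cardinal_add iA a))).
  apply: eq_cardinal_add (card_eqxx _) _.
  exact/card_esym/cardinal_add_absorb.
apply: (card_eq_trans (cardinal_addA _ _ _)).
apply: card_esym; apply: (card_eq_trans (eq_cardinal_add ind (card_eqxx q))).
apply: (card_eq_trans (card_esym (cardinal_addA _ _ _))).
apply: eq_cardinal_add (card_eqxx _) _.
apply: (card_eq_trans (card_esym (cardinal_addA _ _ _))).
apply: card_esym; apply: (card_eq_trans adq).
apply: eq_cardinal_add (card_eqxx _) _.
exact/card_esym/cardinal_add_absorb.
Qed.

End index_arithmetic.

(** * Operator norm closures and linear homeomorphisms *)

Section closures.
Context {R : realType}.
Implicit Types (H K : hilbertType R).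

Lemma norm_closureP H K (S : set 'B(H, K)) (B : 'B(H, K)) :
  norm_closure S B <-> forall e : R, 0 < e ->
    exists2 T, S T & forall x, nm (B x - T x) <= e * nm x.
Proof.
split=> h e e0.
  by have [T ST /opnorm_lt BT] := h _ e0; exists T.
have [|T ST BT] := h (e / 2); first by rewrite divr_gt0.
exists T => //; apply: (@le_lt_trans _ _ (e / 2)); last first.
  by rewrite ltr_pdivrMr// mulr_natr mulr2n ltrDl.
by apply: opnorm_le => //; rewrite divr_ge0// ltW.
Qed.

Lemma adjoint_dist H K (S T : 'B(H, K)) (e : R) : 0 <= e ->
  (forall x, nm (S x - T x) <= e * nm x) ->
  forall y, nm (adjoint S y - adjoint T y) <= e * nm y.
Proof.
move=> e0 h.
have [D hD] : exists D : 'B(H, K), forall x, D x = S x - T x.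
  apply: mk_op; last by exists e.
  by move=> a x y; rewrite !opD !opZ opprD addrACA scalerBr.
have aD y : adjoint D y = adjoint S y - adjoint T y.
  by apply: dot_inj => z; rewrite -adjointE hD dotBl dotBr !adjointE.
move=> y; rewrite -aD; apply: adjoint_bound => // x.
by rewrite hD.
Qed.

Lemma op_continuous H K (T : 'B(H, K)) : continuous T.
Proof.
move=> x B /nbhs_rnormP[e e0 hB]; apply/nbhs_rnormP.
have [M M0 hM] := op_bound T.
have M1 : 0 < M + 1 by rewrite ltr_wpDl.
exists (e / (M + 1)); first by rewrite divr_gt0.
move=> y xy; apply: hB; rewrite -opB; apply: le_lt_trans (hM _) _.
move: xy; rewrite ltr_pdivlMr// mulrC; apply: le_lt_trans.
by rewrite ler_wpM2r ?rnorm_ge0// lerDl.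
Qed.

(** An inverse that is continuous at zero is bounded. *)
Lemma linear_homeoP H (G : 'B(H, H)) :
  linear_homeo G <-> exists G' : 'B(H, H), cancel G G' /\ cancel G' G.
Proof.
split; last first.
  by move=> [G' [GK G'K]]; split; [exact: op_continuous|];
    exists G'; split=> //; exact: op_continuous.
move=> [_ [G' [GK G'K G'c]]].
have G'0 : G' 0 = 0 by rewrite -[in LHS](op0 G) GK.
have /nbhs_rnormP[r r0 hr] : nbhs (0 : H) [set y | nm (0 - G' y) < 1].
  apply: (G'c 0 [set z | nm (0 - z) < 1]); rewrite G'0.
  by apply/nbhs_rnormP; exists 1.
have G'lin (a : R[i]) x y : G' (a *: x + y) = a *: G' x + G' y.
  by rewrite -{1}[x]G'K -{1}[y]G'K -opZ -opD GK.
have [T hT] : exists T : 'B(H, H), forall x, T x = G' x.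
  apply: mk_op => //; exists (2 / r) => y.
  have [->|/eqP y0] := eqVneq y 0; first by rewrite G'0 !rnorm0 mulr0.
  have ny := rnorm_gt0 y0.
  pose s : R := r / 2 / nm y.
  have s0 : 0 < s by rewrite !divr_gt0.
  have G'Z : G' (s%:C *: y) = s%:C *: G' y.
    by have := G'lin s%:C y 0; rewrite G'0 !addr0.
  have : nm (0 - G' (s%:C *: y)) < 1.
    apply: hr; rewrite sub0r rnormN rnormZr gtr0_norm//.
    rewrite /s divfK ?gt_eqF// ltr_pdivrMr// mulr_natr mulr2n ltrDl//.
  rewrite sub0r rnormN G'Z rnormZr gtr0_norm// mulrC -ltr_pdivlMr// div1r.
  by rewrite /s invf_div mulrC invf_div => /ltW; rewrite mulrC.
by exists T; split=> x; rewrite hT ?GK ?G'K.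
Qed.

Lemma adjoint_homeo H (G : 'B(H, H)) :
  linear_homeo G -> linear_homeo (adjoint G).
Proof.
move=> /linear_homeoP[G' [GK G'K]]; apply/linear_homeoP; exists (adjoint G').
by split=> x; apply: dot_inj => z; rewrite -!adjointE ?GK ?G'K.
Qed.

Lemma closed_dominated_bound H K L (A : 'B(K, L)) (B : 'B(H, L)) :
  closed_dominated (A \o adjoint A) (B \o adjoint B) ->
  forall eta : R, 0 < eta -> exists2 c : R, 0 < c & forall y,
    nm (adjoint B y) ^+ 2 <= eta * nm y ^+ 2 + c * nm (adjoint A y) ^+ 2.
Proof.
move=> /norm_closureP h eta eta0.
have [S [_ [c c0 Sc]] BS] := h _ eta0.
exists c => // y.
have -> : nm (adjoint B y) ^+ 2 =
    complex.Re (hdot (B (adjoint B y) - S y) y) + complex.Re (hdot (S y) y).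
  by rewrite -ReD -dotDl subrK adjointE rnorm_sqr_dot.
apply: lerD.
  apply: le_trans (Re_dot_le _ _) _; rewrite expr2 mulrA ler_wpM2r ?rnorm_ge0//.
  exact: BS.
have := Sc y; rewrite lecE => /andP[_]; rewrite dotZl ReZ => /le_trans; apply.
by rewrite /= adjointE -rnorm_sqr_dot.
Qed.

(** Let [eta] tend to zero in the previous bound. *)
Lemma dominated_ker H K L (A : 'B(K, L)) (B : 'B(H, L)) :
  closed_dominated (A \o adjoint A) (B \o adjoint B) ->
  forall y, adjoint A y = 0 -> adjoint B y = 0.
Proof.
move=> /closed_dominated_bound h y Ay.
apply/rnorm_eq0/eqP; rewrite -sqrf_eq0; apply/eqP/le_anti.
rewrite sqr_ge0 andbT; apply/ler_addgt0Pr => e e0; rewrite add0r.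
have n1 : 0 < nm y ^+ 2 + 1 by rewrite ltr_wpDl// sqr_ge0.
have [c _ hc] := h _ (divr_gt0 e0 n1).
apply: le_trans (hc y) _; rewrite Ay rnorm0 expr0n mulr0 addr0.
by rewrite mulrAC ler_pdivrMr// ler_pM2l// lerDl.
Qed.

End closures.

(** * Closures of orbits *)

Section orbits.
Context {R : realType}.
Implicit Types (H K : hilbertType R).

Lemma adjoint_image H K (B : 'B(H, K)) (X : set K) : closed_subspace X ->
  (forall y, orth X y -> adjoint B y = 0) ->
  adjoint B @` X = range (adjoint B).
Proof.
move=> Xc BX; apply/seteqP; split; first by move=> _ [y _ <-]; exists y.
move=> _ [y _ <-]; exists (proj X y); first exact: proj_in.
by apply/esym/eqP; rewrite -subr_eq0 -opB BX//; exact: proj_orth.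
Qed.

(** [(A \o G) (A \o G)*] is dominated by [AA*] with the constant given by a
    bound of [G], and it is close to [BB*]. *)
Lemma orbit_closure_dominated H K (A B : 'B(H, K)) :
  norm_closure [set (A \o G : 'B(H, K)) | G in @linear_homeo R H] B ->
  closed_dominated (A \o adjoint A) (B \o adjoint B).
Proof.
move=> /norm_closureP hB; apply/norm_closureP => e e0.
have [M M0 hM] := op_bound B.
have M2 : 0 < 2 * M + 1 by rewrite ltr_wpDl// mulr_ge0.
pose e' := Num.min 1 (e / (2 * M + 1)).
have e'0 : 0 < e' by rewrite lt_min ltr01 divr_gt0.
have e'1 : e' <= 1 by rewrite ge_min lexx.
have e'e : e' * (2 * M + 1) <= e.
  by rewrite -ler_pdivlMr// ge_min lexx orbT.
have [_ [G hG <-] BAG] := hB _ e'0.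
set A' : 'B(H, K) := A \o G in BAG *.
exists (A' \o adjoint A' : 'B(K, K)).
  have A'E y : hdot ((A' \o adjoint A') y) y = (nm (adjoint A' y) ^+ 2)%:C.
    by rewrite /= -dot_self -[A (G _)]/(A' _) adjointE.
  have [N N0 hN] := op_bound (adjoint G).
  split; first by move=> y; rewrite A'E ler0c sqr_ge0.
  exists (N ^+ 2 + 1); first by rewrite ltr_wpDl// sqr_ge0.
  move=> y; rewrite A'E dotZl /= adjointE dot_self -rmorphM lecR.
  rewrite mulrDl mul1r -exprMn.
  apply: (@le_trans _ _ ((N * nm (adjoint A y)) ^+ 2)); last by rewrite lerDl sqr_ge0.
  rewrite ler_pXn2r ?nnegrE ?mulr_ge0 ?rnorm_ge0//.
  by rewrite /A' adjoint_comp; exact: hN.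
have aBAG := adjoint_dist (ltW e'0) BAG.
have aM := adjoint_bound M0 hM.
move=> y /=; rewrite -[A (G _)]/(A' _).
have -> : B (adjoint B y) - A' (adjoint A' y) =
    (B (adjoint B y) - A' (adjoint B y)) + A' (adjoint B y - adjoint A' y).
  by rewrite opB addrA subrK.
apply: le_trans (rnormD _ _) _.
have h1 : nm (B (adjoint B y) - A' (adjoint B y)) <= e' * (M * nm y).
  by apply: le_trans (BAG _) _; rewrite ler_wpM2l ?(ltW e'0).
have h2 x : nm (A' x) <= (M + 1) * nm x.
  have := rnormD (A' x - B x) (B x); rewrite subrK rnormB.
  have : e' * nm x <= nm x by rewrite ler_piMl ?rnorm_ge0.
  by have := BAG x; have := hM x; rewrite mulrDl mul1r; lra.
have h3 : nm (A' (adjoint B y - adjoint A' y)) <= (M + 1) * (e' * nm y).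
  apply: le_trans (h2 _) _; rewrite ler_wpM2l ?addr_ge0//.
have h4 : e' * (2 * M + 1) * nm y <= e * nm y by rewrite ler_wpM2r ?rnorm_ge0.
apply: le_trans h4; apply: le_trans (lerD h1 h3) _.
by rewrite le_eqVlt; apply/orP; left; apply/eqP; ring.
Qed.

(** Being close to [A \o G], the operator [B] may be replaced by [A \o G] in the
    computation of the codimension of [B @` V], for [V] of least codimension
    among the subspaces on which [B] is bounded below, and similarly for the
    adjoints. *)
Lemma orbit_closure_index H K (A B : 'B(H, K)) :
  norm_closure [set (A \o G : 'B(H, K)) | G in @linear_homeo R H] B ->
  iota_i B #=
    cardinal_add (iota_i A) (iota_i_on (closure (range A)) (adjoint B)).
Proof.
move=> hB.
have kill := dominated_ker (orbit_closure_dominated hB).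
move: hB => /norm_closureP hB.
set X := closure (range A).
have Xc : closed_subspace X := closed_closure_range A.
have orthX y : orth X y <-> adjoint A y = 0.
  by rewrite /X orth_closure -ker_adjoint.
have BX x : X (B x).
  rewrite /X closure_range => y Ay.
  by rewrite adjointE kill// dot0r.
have near c : 0 < c -> exists A' : 'B(H, K), [/\ range A' = range A,
    hdim (ker A') #= hdim (ker A), forall y, adjoint A' y = 0 <-> adjoint A y = 0 &
    forall x, nm (A' x - B x) <= c * nm x].
  move=> c0; have [_ [G hG <-] BAG] := hB _ c0.
  have [G' [GK G'K]] := (linear_homeoP G).1 hG.
  have rE : range (A \o G) = range A.
    apply/seteqP; split=> _ [x _ <-]; first by exists (G x).
    by exists (G' x) => //=; rewrite G'K.
  exists (A \o G : 'B(H, K)); split=> //.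
  - apply: (@eq_hdim _ _ _ _ _ G); [exact: closed_ker|exact: closed_ker| | |].
    + by move=> x.
    + by move=> x _ /(congr1 G'); rewrite GK op0.
    + move=> x Ax; apply: subset_closure; exists (G' x); rewrite ?G'K//.
      by rewrite /ker /= G'K.
  - move=> y; rewrite -[adjoint _ y = 0]/(ker _ y) -[adjoint A y = 0]/(ker _ y).
    by rewrite !ker_adjoint rE.
  - by move=> x; rewrite rnormB; exact: BAG.
rewrite card_eq_le; apply/andP; split.
  (* if [W] has least codimension for the adjoint of [B], then [B] is bounded
     below on the image of [W] under this adjoint *)
  have [W [c [Wc WX Bbb iW]]] := iota_attained (adjoint B) Xc.
  have V1c := closed_image Wc Bbb.
  have Bbb' : bounded_below B (adjoint B @` W) c.
    by have := bounded_below_adjoint Bbb; rewrite adjointK.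
  apply: card_le_trans (iota_le_codim (@closed_subspaceT R H) V1c _ Bbb') _ => //.
  have c4 : 0 < c / 4 by rewrite divr_gt0// Bbb.1.
  have [A' [rA' kA' aA' A'B]] := near _ c4.
  have A'B' := adjoint_dist (ltW c4) A'B.
  have [A'bb eqV] : bounded_below (adjoint A') W (c - c / 4) /\
      hdim (ominus [set: H] (adjoint A' @` W)) #=
      hdim (ominus [set: H] (adjoint B @` W)).
    apply: hdim_perturb => //.
    by have [c0 _] := Bbb; lra.
  apply: card_le_trans (card_eqWr eqV) _.
  have Zc := closed_ominus (adjoint A' @` W) (@closed_subspaceT R H).
  have kZ : ker A' `<=` ominus [set: H] (adjoint A' @` W).
    by move=> x Ax; split=> // _ [y _ <-]; rewrite -adjointE Ax dot0l.
  apply: card_le_trans (card_eqW (hdim_ominus (closed_ker A') Zc kZ)) _.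
  apply: le_cardinal_add.
    apply: card_le_trans (card_eqW kA') _.
    rewrite /iota_i /iota_i_on (_ : [set x | _] = ker A); last first.
      by apply/seteqP; split=> x //= [].
    exact: le_cardinal_addl.
  apply: card_le_trans (card_eqWr iW).
  apply: card_le_trans (card_eqWr (codim_image Xc Wc WX A'bb)).
  apply: card_le_trans (cardinal_addC_le _ _).
  apply: card_le_trans (le_cardinal_addl _ _).
  rewrite (adjoint_image Xc); last by move=> y oy; apply: (aA' y).2; exact: (orthX y).1.
  rewrite closure_range_adjoint (_ : ominus (ominus _ _) _ = ominus (orth (ker A')) (adjoint A' @` W)).
    exact: card_lexx.
  by rewrite !ominusE setTI setIC.
(* if [V] has least codimension for [B], then the adjoint of [B] is bounded
   below on [B @` V], and [A'] on [V] *)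
have [V [c [Vc _ Bbb iV]]] := iota_attained B (@closed_subspaceT R H).
apply: card_le_trans (card_eqWr iV).
have c4 : 0 < c / 4 by rewrite divr_gt0// Bbb.1.
have [A' [rA' kA' aA' A'B]] := near _ c4.
have A'X : A' @` V `<=` X.
  by move=> _ [x _ <-]; apply: subset_closure; rewrite -rA'; exists x.
have [A'bb eqV] : bounded_below A' V (c - c / 4) /\
    hdim (ominus X (A' @` V)) #= hdim (ominus X (B @` V)).
  apply: hdim_perturb => //; first by move=> _ [x _ <-].
  by have [c0 _] := Bbb; lra.
have cod := codim_image (@closed_subspaceT R H) Vc (@subsetT _ V) A'bb.
rewrite rA' -/X in cod.
apply: (index_ge (a := hdim (ominus X (A' @` V)))).
- apply: card_eq_trans cod _; apply: eq_cardinal_add; last exact: card_eqxx.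
  rewrite (_ : [set x | _] = ker A'); last by apply/seteqP; split=> x //= [].
  rewrite (_ : [set x | _] = ker A)//.
  by apply/seteqP; split=> x //= [].
- by apply: IC_absorbing; apply: subspace_image; exact: (@closed_subspaceT R H).1.
- have := IC_le_codim (@closed_subspaceT R H) Vc (@subsetT _ V) A'bb.
  by rewrite rA'.
- apply: card_le_trans (card_eqWr eqV).
  have BVX : B @` V `<=` X by move=> _ [x _ <-].
  exact: iota_le_codim Xc (closed_image Vc Bbb) BVX (bounded_below_adjoint Bbb).
Qed.

(** First cut at a level [t ^ 2 / c] of [AA*], below which the domination makes
    [B*] small, to get a subspace [U] of the range of [A]; then cut at the level
    [t ^ 2] of [BB*] compressed to [U]. *)
Lemma dominated_cut H K (A B : 'B(H, K)) (e : R) : 0 < e ->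
  closed_dominated (A \o adjoint A) (B \o adjoint B) ->
  exists W c, [/\ closed_subspace W, W `<=` range A,
    bounded_below (adjoint B) W c &
    forall y, orth W y -> nm (adjoint B y) <= e * nm y].
Proof.
move=> e0 dom.
pose t := e / 3; have t0 : 0 < t by rewrite divr_gt0.
have t2 : 0 < t ^+ 2 by rewrite exprn_gt0.
have [c c0 hc] := closed_dominated_bound dom t2.
have [U [Uc UA _ oU]] := range_cut A (divr_gt0 t2 c0).
have BoU y : orth U y -> nm (adjoint B y) <= 2 * t * nm y.
  move=> oy; apply: sqr_le; first by rewrite !mulr_ge0 ?rnorm_ge0// ltW.
  apply: le_trans (hc y) _.
  have h : c * nm (adjoint A y) ^+ 2 <= t ^+ 2 * nm y ^+ 2.
    by rewrite -ler_pdivlMl// mulrA [c^-1 * _]mulrC; exact: oU.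
  have h' : 0 <= t ^+ 2 * nm y ^+ 2 by rewrite mulr_ge0// sqr_ge0.
  rewrite -mulrA [(2 * _) ^+ 2]exprMn [(t * _) ^+ 2]exprMn -natrX.
  by move: h h'; move: (t ^+ 2 * nm y ^+ 2) => *; lra.
pose B' : 'B(H, K) := proj U \o B.
have B'E y : adjoint B' y = adjoint B (proj U y).
  by rewrite /B' adjoint_comp adjoint_proj.
have [W [Wc WB' [c' Wbb] oW]] := range_cut B' t2.
have WU : W `<=` U by move=> w /WB'[x _ <-]; exact: proj_in.
exists W, c'; split=> //.
- by move=> w /WU/UA.
- split; first exact: Wbb.1.
  by move=> w Ww; have := Wbb.2 _ Ww; rewrite B'E proj_id//; exact: WU.
- move=> y oy; rewrite -[y in adjoint B y](subrK (proj U y)) opD -B'E.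
  apply: le_trans (rnormD _ _) _.
  have h1 : nm (adjoint B' y) <= t * nm y.
    apply: sqr_le; first by rewrite mulr_ge0 ?rnorm_ge0// ltW.
    by rewrite exprMn; exact: oW.
  have h2 : nm (adjoint B (y - proj U y)) <= 2 * t * nm y.
    apply: le_trans (BoU _ (proj_orth Uc y)) _.
    by rewrite ler_wpM2l ?projC_le// mulr_ge0// ltW.
  apply: le_trans (lerD h2 h1) _; rewrite -mulrDl ler_wpM2r ?rnorm_ge0//.
  by rewrite /t; lra.
Qed.

Lemma ominus_orth_image H K (B : 'B(H, K)) (X W : set K) :
  closed_subspace X -> (forall y, orth X y -> adjoint B y = 0) ->
  ominus (closure (adjoint B @` X)) (adjoint B @` W) =
  ominus (orth (adjoint B @` W)) (ker B).
Proof.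
move=> Xc BX; rewrite (adjoint_image Xc)// closure_range_adjoint.
by rewrite !ominusE setIC.
Qed.

(** The first space is the kernel of [proj W \o B]. Both dimensions are computed
    by [codim_image], which produces the terms of the index formula other than
    the values of [IC]; these values are absorbed by the codimensions of the
    images of [V] and [W]. *)
Lemma index_complement H K (A B : 'B(H, K)) (W : set K) (V : set H) (c c' : R) :
  closed_subspace W -> bounded_below (adjoint B) W c ->
  closed_subspace V -> bounded_below A V c' -> A @` V = W ->
  (forall y, adjoint A y = 0 -> adjoint B y = 0) ->
  iota_i B #=
    cardinal_add (iota_i A) (iota_i_on (closure (range A)) (adjoint B)) ->
  hdim (orth (adjoint B @` W)) #= hdim (orth V).
Proof.
move=> Wc Bbb Vc Abb AV kill ind.
set X := closure (range A) in ind *.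
have Xc : closed_subspace X := closed_closure_range A.
have WX : W `<=` X.
  by rewrite -AV => _ [x _ <-]; apply: subset_closure; exists x.
have BX y : orth X y -> adjoint B y = 0.
  by rewrite /X orth_closure -ker_adjoint => /kill.
have Tc := @closed_subspaceT R H.
have V1c := closed_image Wc Bbb.
have Bbb' : bounded_below B (adjoint B @` W) c.
  by have := bounded_below_adjoint Bbb; rewrite adjointK.
have kerE (T : 'B(H, K)) : [set x | [set: H] x /\ T x = 0] = ker T.
  by apply/seteqP; split=> x //= [].
have oE (Z : set H) : ominus [set: H] Z = orth Z by rewrite ominusE setTI.
have codA := codim_image Tc Vc (@subsetT _ V) Abb.
have codB' := codim_image Xc Wc WX Bbb.
have codB := codim_image Tc V1c (@subsetT _ _) Bbb'.
rewrite kerE oE AV -/X in codA; rewrite kerE oE in codB.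
rewrite /iota_i /iota_i_on !kerE in ind.
apply: (index_cancel codA _ _ codB' _ _ _ codB _ _ ind).
- exact/IC_absorbing/subspace_image/Tc.1.
- by have := IC_le_codim Tc Vc (@subsetT _ V) Abb; rewrite AV.
- exact/IC_absorbing/subspace_image/Xc.1.
- exact: IC_le_codim Bbb.
- rewrite ominus_orth_image//.
  apply: hdim_ominus; [exact: closed_ker|exact: closed_orth|].
  by move=> x Bx _ [y _ <-]; rewrite -adjointE Bx dot0l.
- exact/IC_absorbing/subspace_image/Tc.1.
- exact: IC_le_codim Bbb'.
Qed.

(** [G] is built from two pieces: on the complement of the kernel [N] of
    [proj W \o B] it is the solution of [A (G x) = proj W (B x)] in [V]; on [N]
    it is a small multiple of an isometry onto the complement of [V]. *)
Lemma index_orbit_closure H K (A B : 'B(H, K)) :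
  closed_dominated (A \o adjoint A) (B \o adjoint B) ->
  iota_i B #=
    cardinal_add (iota_i A) (iota_i_on (closure (range A)) (adjoint B)) ->
  norm_closure [set (A \o G : 'B(H, K)) | G in @linear_homeo R H] B.
Proof.
move=> dom ind; apply/norm_closureP => e e0.
have e2 : 0 < e / 2 by rewrite divr_gt0.
have [W [c [Wc WA Bbb oW]]] := dominated_cut e2 dom.
have [V [c' [Vc _ Abb AV]]] := bounded_below_section Wc WA.
have dims := index_complement Wc Bbb Vc Abb AV (dominated_ker dom) ind.
set V1 := adjoint B @` W in dims.
have V1c : closed_subspace V1 := closed_image Wc Bbb.
have oVc := closed_orth V; have Nc := closed_orth V1.
set N := orth V1 in dims Nc.
have [L [LV AL LA]] := bounded_below_inverse Vc Wc Abb AV.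
pose C : 'B(H, K) := proj W \o B.
have CE y : W y -> adjoint C y = adjoint B y.
  by move=> Wy; rewrite /C adjoint_comp adjoint_proj// proj_id.
have C0 x : N x -> C x = 0.
  move=> Nx; apply: dot_self0; rewrite adjointE CE; last exact: proj_in.
  by apply: Nx; exists (C x) => //; exact: proj_in.
have CV1 : adjoint C @` W = V1.
  by apply/seteqP; split=> _ [y Wy <-]; exists y => //; rewrite CE.
have Cbb' : bounded_below (adjoint C) W c.
  by split=> [|y Wy]; [exact: Bbb.1|rewrite CE//; exact: Bbb.2].
have Cbb : bounded_below C V1 c.
  by have := bounded_below_adjoint Cbb'; rewrite adjointK CV1.
have CVW : C @` V1 = W.
  have Ic := closed_image V1c Cbb.
  apply/seteqP; split; first by move=> _ [x _ <-]; exact: proj_in.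
  move=> w Ww; set q := w - proj (C @` V1) w.
  have Ip : (C @` V1) (proj (C @` V1) w) by exact: proj_in.
  have Wq : W q.
    by apply: (subspaceB Wc.1) => //; case: Ip => x _ <-; exact: proj_in.
  have : adjoint C q = 0.
    apply: dot_self0; rewrite adjointE'; apply: (proj_orth Ic).
    by exists (adjoint C q) => //; rewrite -CV1; exists q.
  move=> /(bounded_below_inj Cbb' Wq) /eqP; rewrite subr_eq0 => /eqP ->.
  exact: Ip.
have [M [MV1 CM MC]] := bounded_below_inverse V1c Wc Cbb CVW.
have [U [UoV Uiso U0 UN]] := hdim_isometry Nc oVc dims.
have Ubb : bounded_below U N 1.
  by split=> // x Nx; rewrite mul1r Uiso.
have [U' [U'N UU' U'U]] := bounded_below_inverse Nc oVc Ubb UN.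
have [a a0 ha] := op_bound A.
have a1 : 0 < a + 1 by rewrite ltr_wpDl.
pose t := e / 2 / (a + 1); have t0 : 0 < t by rewrite divr_gt0.
have comb (S1 S2 : 'B(H, H)) (s : R) :
    exists S : 'B(H, H), forall x, S x = S1 x + s%:C *: S2 x.
  apply: mk_op.
    move=> b x y; rewrite !opD !opZ !scalerDr !scalerA [s%:C * b]mulrC.
    by rewrite [LHS]addrACA.
  have [M1 M10 hM1] := op_bound S1; have [M2 M20 hM2] := op_bound S2.
  exists (M1 + `|s| * M2) => x; apply: le_trans (rnormD _ _) _.
  by rewrite mulrDl lerD// rnormZr -mulrA ler_wpM2l.
have [G hG] : exists G : 'B(H, H), forall x, G x = L (C x) + t%:C *: U x.
  exact: (comb (L \o C : 'B(H, H))).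
have [G' hG'] : exists G' : 'B(H, H), forall x,
    G' x = M (A (proj V x)) + t^-1%:C *: U' x.
  exact: (comb (M \o (A \o proj V : 'B(H, K)) : 'B(H, H))).
have UoV' x : U x = U (proj N x).
  by rewrite -{1}(subrK (proj N x) x) opD U0 ?add0r//; exact: proj_orth.
have tt x : t%:C *: (t^-1%:C *: x) = x :> H.
  by rewrite scalerA -rmorphM mulfV ?gt_eqF// scale1r.
have tt' x : t^-1%:C *: (t%:C *: x) = x :> H.
  by rewrite scalerA -rmorphM mulVf ?gt_eqF// scale1r.
have pV x : proj V (G x) = L (C x).
  rewrite hG opD opZ proj_id// (proj_orth0 Vc (UoV x)).
  by rewrite scaler0 addr0.
have MCx x : M (C x) = proj V1 x.
  rewrite -{1}(subrK (proj V1 x) x) opD C0 ?add0r; last exact: proj_orth.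
  by apply: MC; exact: proj_in.
have U'Ux x : U' (U x) = proj N x.
  by rewrite UoV' U'U//; exact: (proj_in Nc).
have U'0 x : V x -> U' x = 0.
  move=> Vx; apply: (bounded_below_inj Ubb) => //; rewrite UU'.
  by apply: proj_orth0 => // y oy; exact/dot_eq0C/oy.
have homeo : linear_homeo G.
  apply/linear_homeoP; exists G'; split=> x.
    rewrite hG' pV AL (proj_id Wc); last exact: proj_in.
    rewrite MCx hG opD opZ U'0 ?add0r; last exact: LV.
    rewrite U'Ux tt' /N proj_orthE//.
    by rewrite addrC subrK.
  have CG' : C (G' x) = A (proj V x).
    rewrite hG' opD opZ (C0 (U' x)) ?scaler0 ?addr0// CM proj_id//.
    by rewrite -AV; exists (proj V x) => //; exact: proj_in.
  rewrite hG CG' LA; last exact: proj_in.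
  rewrite hG' opD opZ UU' U0 ?add0r; last first.
    by rewrite /N orth_orth.
  by rewrite tt proj_orthE// addrC subrK.
exists (A \o G : 'B(H, K)); first by exists G.
move=> x; rewrite /= hG opD opZ /= AL (proj_id Wc); last exact: proj_in.
rewrite opprD addrA; apply: le_trans (rnormD _ _) _; rewrite rnormN.
have -> : e = e / 2 + e / 2 by exact: splitr.
rewrite mulrDl; apply: lerD.
  rewrite /C /=; set z := B x - proj W (B x).
  have oz : orth W z by exact: proj_orth.
  have Bz : B x = z + proj W (B x) by rewrite /z subrK.
  clearbody z; have [->|/eqP z0] := eqVneq z 0.
    by rewrite rnorm0 mulr_ge0 ?rnorm_ge0// ltW.
  rewrite -(ler_pM2l (rnorm_gt0 z0)) -expr2 rnorm_sqr_dot.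
  have -> : hdot z z = hdot x (adjoint B z).
    have pz : hdot (proj W (B x)) z = 0.
      by apply: dot_eq0C; apply: oz; exact: proj_in.
    by rewrite -adjointE Bz dotDl pz addr0.
  apply: le_trans (Re_dot_le _ _) _.
  have := oW _ oz; have := rnorm_ge0 x => x0 h.
  apply: le_trans (ler_wpM2l x0 h) _.
  by rewrite le_eqVlt; apply/orP; left; apply/eqP; ring.
rewrite rnormZr (gtr0_norm t0) /t -[_ / (a + 1) * _]mulrA ler_pM2l//.
rewrite ler_pdivrMl//; apply: le_trans (ha _) _.
rewrite UoV' Uiso; last exact: (proj_in Nc).
by apply: ler_pM; rewrite ?rnorm_ge0 ?lerDl// proj_le.
Qed.

Lemma orbit_closureE H K (A : 'B(H, K)) :
  norm_closure [set (A \o G : 'B(H, K)) | G in @linear_homeo R H] =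
  [set B : 'B(H, K) |
    closed_dominated (A \o adjoint A) (B \o adjoint B) /\
    iota_i B #=
      cardinal_add (iota_i A) (iota_i_on (closure (range A)) (adjoint B))].
Proof.
apply/seteqP; split=> B; last by case; exact: index_orbit_closure.
by move=> hB; split; [exact: orbit_closure_dominated|exact: orbit_closure_index].
Qed.

(** [adjoint T] maps a closed subspace of [range T] to one that has the same
    codimension in the closure of its own range. *)
Lemma IC_adjoint_le H K (T : 'B(H, K)) :
  IC (range (adjoint T)) #<= IC (range T).
Proof.
have [V0 [V0c V0T -> _]] := ICP (subspace_image T (@closed_subspaceT R H).1).
have [V [c [Vc _ Tbb TV]]] := bounded_below_section V0c V0T.
set X := closure (range T).
have Xc : closed_subspace X := closed_closure_range T.
have V0X : V0 `<=` X by move=> y /V0T; exact: subset_closure.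
have bb := bounded_below_adjoint Tbb; rewrite TV in bb.
apply: card_le_trans (card_eqWr (codim_image Xc V0c V0X bb)).
apply: card_le_trans (cardinal_addC_le _ _).
apply: card_le_trans (le_cardinal_addl _ _).
have XE : adjoint T @` X = range (adjoint T).
  by apply: adjoint_image => // y; rewrite /X orth_closure -ker_adjoint.
by have := IC_le_codim Xc V0c V0X bb; rewrite XE.
Qed.

Lemma IC_adjoint H K (T : 'B(H, K)) :
  IC (range (adjoint T)) #= IC (range T).
Proof.
rewrite card_eq_le IC_adjoint_le /=.
by have := IC_adjoint_le (adjoint T); rewrite adjointK.
Qed.

Lemma iota_f_adjoint H K (T : 'B(H, K)) : iota_i (adjoint T) #= iota_f T.
Proof.
apply: eq_cardinal_add; last exact: IC_adjoint.
rewrite (_ : [set y | _] = ominus [set: K] (closure (range T))).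
  exact: card_eqxx.
rewrite ominusE setTI orth_closure -ker_adjoint.
by apply/seteqP; split=> y //= [].
Qed.

(** Taking adjoints is isometric and maps linear homeomorphisms to linear
    homeomorphisms. *)
Lemma left_orbit_closureE H K (A B : 'B(H, K)) :
  norm_closure [set (G \o A : 'B(H, K)) | G in @linear_homeo R K] B <->
  norm_closure [set (adjoint A \o G : 'B(K, H)) | G in @linear_homeo R K]
    (adjoint B).
Proof.
split=> /norm_closureP h; apply/norm_closureP => e e0.
  have [_ [G hG <-] BGA] := h _ e0.
  exists (adjoint A \o adjoint G : 'B(K, H)).
    by exists (adjoint G) => //; exact: adjoint_homeo.
  move=> y; have := adjoint_dist (ltW e0) BGA y.
  by rewrite adjoint_comp.
have [_ [G hG <-] BGA] := h _ e0.
exists (adjoint G \o A : 'B(H, K)).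
  by exists (adjoint G) => //; exact: adjoint_homeo.
move=> x; have := adjoint_dist (ltW e0) BGA x.
by rewrite adjoint_comp !adjointK.
Qed.

End orbits.

Theorem theorem6p6 (R : realType) (H K : hilbertType R) (A : 'B(H, K)) :
  norm_closure
    [set (A \o G : 'B(H, K)) | G in @linear_homeo R H] =
  [set B : 'B(H, K) |
    closed_dominated (A \o adjoint A) (B \o adjoint B) /\
    iota_i B #=
      cardinal_add (iota_i A) (iota_i_on (closure (range A)) (adjoint B))]
  /\
  norm_closure
    [set (G \o A : 'B(H, K)) | G in @linear_homeo R K] =
  [set B : 'B(H, K) |
    closed_dominated (adjoint A \o A) (adjoint B \o B) /\
    iota_f B #=
      cardinal_add (iota_f A) (iota_i_on (closure (range (adjoint A))) B)].
Proof.
split; first exact: orbit_closureE.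
apply/seteqP; split=> B.
  move=> /left_orbit_closureE; rewrite orbit_closureE adjointK => -[].
  rewrite adjointK => dom ind.
  split=> //; apply: (card_eq_trans (card_esym (iota_f_adjoint B))).
  apply: (card_eq_trans ind).
  exact: eq_cardinal_add (iota_f_adjoint A) (card_eqxx _).
move=> [dom ind]; apply/left_orbit_closureE; rewrite orbit_closureE adjointK.
split; rewrite adjointK//; apply: (card_eq_trans (iota_f_adjoint B)).
apply: (card_eq_trans ind).
exact: eq_cardinal_add (card_esym (iota_f_adjoint A)) (card_eqxx _).
Qed.
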